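(* Let $\alpha_0>0$, $\eta>0$ and $\gamma>0$. There exist positive constants $C$ and $c$ depending only on $\alpha_0$, $\eta$ and $\gamma$ such that, for all $\varepsilon>0$ and $B>0$ with $\varepsilon/B<1$, the inequality $$\mathrm{E}_{\theta_0,\varepsilon^2}\Big[\Pi\Big(\big\{\theta:\ \|\theta-\theta_0\|^2/B^2\ \ge\ C(\varepsilon/B)^{4\alpha_0/(2\alpha_0+1)}\big\}\ \Big|\ X\Big)\Big]\ \le\ \exp\big\{-c\,(B/\varepsilon)^{2/(2\alpha_0+1)}\big\}$$ holds uniformly in $\theta_0\in\mathcal{E}(\alpha_0,B)$.
   Context: Here $\mathbb{N}=\{1,2,\ldots\}$, and $\|v\|^2=\sum_{i\ge1}v_i^2$ for $v\in l_2$. Gaussian infinite sequence model: for $\theta\in l_2$ and $\varepsilon>0$, the observation $X=(X_1,X_2,\ldots)$ has law $P_{\theta,\varepsilon^2}=\otimes_{i=1}^\infty\mathcal{N}(\theta_i,\varepsilon^2)$; $\mathrm{E}_{\theta,\varepsilon^2}$ denotes expectation under $P_{\theta,\varepsilon^2}$. The variance $\varepsilon^2$ is known. Sobolev ellipsoid: $\mathcal{E}(\alpha_0,B)=\{\theta\in l_2:\sum_{i=1}^\infty i^{2\alpha_0}\theta_i^2\le B^2\}$. Prior: $\mathcal N(0,0)$ denotes the point mass at $0$. For $d\in\mathbb{N}$ and $\alpha>0$ let $\mathrm{S}(\cdot\mid d,\alpha)=\big[\otimes_{i=1}^d\mathcal{N}(0,\varepsilon^2 d^{2\alpha+1}i^{-(2\alpha+1)})\big]\otimes\big[\otimes_{i=d+1}^\infty\mathcal{N}(0,0)\big]$,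 a distribution on $l_2$. Let $M$ and $F$ be the probability distributions on $\mathbb{N}$ with $M(d)\propto\exp(-\eta d)$ and $F(k)\propto\exp(-\gamma k)$. Put $\mathrm{S}_M(\cdot\mid\alpha)=\sum_{d=1}^\infty M(d)\,\mathrm{S}(\cdot\mid d,\alpha)$ and $\Pi=\sum_{k=1}^\infty F(k)\,\mathrm{S}_M(\cdot\mid\alpha=k)$ (so $\Pi$ depends on $\varepsilon,\eta,\gamma$ but not on $\alpha_0$ or $B$). $\Pi(\cdot\mid X)$ is the posterior distribution of $\theta$ given $X$, i.e. $\Pi(A\mid X)=\int_A \frac{dP_{\theta,\varepsilon^2}}{dP_{0,\varepsilon^2}}(X)\,d\Pi(\theta)\big/\int \frac{dP_{\theta,\varepsilon^2}}{dP_{0,\varepsilon^2}}(X)\,d\Pi(\theta)$. *)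

(* Defs.v *)
From HB Require Import structures.
From mathcomp Require Import all_boot all_order all_algebra.
From mathcomp Require Import all_classical all_reals all_analysis.
From mathcomp Require Import measurable_realfun.
Set Implicit Arguments.
Unset Strict Implicit.
Unset Printing Implicit Defensive.
Import Order.TTheory GRing.Theory Num.Theory.
Import numFieldNormedType.Exports.
Local Open Scope classical_set_scope.
Local Open Scope ring_scope.

(* Sequences are 0-based: [x i] is the coordinate with mathematical index
   [i.+1]. *)
Definition coord_sets (R : realType) : set (set (nat -> R)) :=
  [set A | exists i : nat, exists2 U : set R,
     measurable U & A = [set x | U (x i)]].

(* R^N with the product sigma-algebra; l_2 is one of its measurable sets, and
   the trace on l_2 is the Borel sigma-algebra of the norm. *)
Definition rseq (R : realType) := g_sigma_algebraType (@coord_sets R).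

Definition coord (R : realType) (x : rseq R) : nat -> R := x.
Coercion coord : rseq >-> Funclass.

Section rseq_measurability.
Context (R : realType).

Lemma measurable_coord (i : nat) :
  measurable_fun [set: rseq R] (fun x : rseq R => x i).
Proof.
move=> _ U mU; rewrite setTI; apply: sub_gen_smallest.
by exists i, U.
Qed.

Lemma measurable_to_rseq d (T : measurableType d) (f : T -> rseq R) :
  (forall i, measurable_fun setT (fun t => f t i)) -> measurable_fun setT f.
Proof.
move=> mf; apply: (@measurability _ _ _ _ setT f (@coord_sets R)) => //.
move=> _ [A [i [U mU ->]] <-].
exact: (mf i measurableT U mU).
Qed.

Definition set_coord (d : nat) (p : rseq R * measurableTypeR R) : rseq R :=
  fun i => if i == d then p.2 else p.1 i.

Lemma measurable_set_coord d : measurable_fun setT (set_coord d).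
Proof.
apply: measurable_to_rseq => i; rewrite /set_coord /coord.
have [_|_] := eqVneq i d; first exact: measurable_snd.
by apply: (measurableT_comp (measurable_coord i)); exact: measurable_fst.
Qed.

HB.instance Definition _ d := isMeasurableFun.Build _ _ _ _ (set_coord d)
  (@measurable_set_coord d).

End rseq_measurability.

(* Laws on R carry the Borel sets under the display of [measurableTypeR R], as
   [normal_prob] does. *)
Section product_laws.
Context (R : realType).
Implicit Type nu : nat -> probability (measurableTypeR R) R.

(* [P] is the infinite product of the [nu i]; finite-dimensional rectangles
   form a pi-system generating the sigma-algebra, so they determine [P]. *)
Definition is_product_law nu (P : probability (rseq R) R) :=
  forall (n : nat) (U : nat -> set R), (forall i, measurable (U i)) ->
    P [set x | forall i, (i < n)%N -> U i (x i)] =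
    (\prod_(i < n) nu i (U i))%E.

(* The product of [nu 0], ..., [nu d.-1] and of point masses at 0, see
   [finite_product_lawP]. *)
Fixpoint finite_product_law nu (d : nat) : probability (rseq R) R :=
  if d is d'.+1 then
    distribution (finite_product_law nu d' \x nu d')%E (@set_coord R d')
  else \d_((fun=> 0) : rseq R).

Lemma finite_product_lawP nu d :
  is_product_law (fun i => if (i < d)%N then nu i else \d_(0 : measurableTypeR R))
    (finite_product_law nu d).
Proof.
elim: d => [|d IH] n U mU.
  rewrite /= diracE; apply/esym.
  have [U0|] := pselect (forall i, (i < n)%N -> U i 0).
    rewrite mem_set// big1// => i _.
    by rewrite /= diracE mem_set//; exact: U0.
  move=> U0; rewrite memNset//.
  have /existsNP[i /not_implyP[lt_in Ui0]] := U0.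
  by rewrite (bigD1 (Ordinal lt_in))//= diracE memNset// mul0e.
pose V : set R := if (d < n)%N then U d else setT.
pose U' (i : nat) : set R := if i == d then setT else U i.
have mV : @measurable _ (measurableTypeR R) V.
  by rewrite /V; case: ifP => // _; exact: mU.
have mU' i : measurable (U' i) by rewrite /U'; case: ifP.
have mrect : measurable [set x : rseq R | forall i, (i < n)%N -> U' i (x i)].
  rewrite (_ : [set _ | _] =
      \bigcap_(i in [set i | (i < n)%N]) ((fun x : rseq R => x i) @^-1` U' i)).
    apply: fin_bigcap_measurable => [|i _]; first exact: finite_II.
    by rewrite -[X in measurable X]setTI; exact: measurable_coord.
  by apply/seteqP; split => x /= h i; exact: h.
rewrite [LHS](_ : _ = (finite_product_law nu d \x nu d)%E
    ([set x : rseq R | forall i, (i < n)%N -> U' i (x i)] `*` V)); last first.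
  rewrite /= /distribution /pushforward; congr (_ _).
  apply/seteqP; split => -[x t] /=; rewrite /coord /set_coord /U' /V /=.
    move=> h; split=> [i lt_in|].
      by have := h i lt_in; case: eqVneq.
    by case: ifPn => // /h; rewrite eqxx.
  move=> [h hV] i lt_in; have := h i lt_in; case: eqVneq => // id _.
  by move: hV; rewrite -id lt_in.
rewrite product_measure1E//.
rewrite [X in (X * _)%E](IH n U' mU') /V /U'.
have [lt_dn|le_nd] := ltnP d n.
  rewrite (bigD1 (Ordinal lt_dn))//= [RHS](bigD1 (Ordinal lt_dn))//=.
  rewrite eqxx ltnn ltnSn [X in (X * _ * _)%E]diracT mul1e muleC; congr (_ * _)%E.
  apply: eq_bigr => i /eqP id.
  have {}id : nat_of_ord i == d = false.
    by apply/eqP => e; apply: id; apply: val_inj.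
  by rewrite id ltnS [in RHS]leq_eqVlt id.
rewrite [X in (_ * X)%E]probability_setT mule1; apply: eq_bigr => i _.
have lt_id : (i < d)%N := leq_trans (ltn_ord i) le_nd.
by rewrite (ltn_eqF lt_id) lt_id ltnS ltnW.
Qed.

End product_laws.

Section model.
Context (R : realType).

Definition sqnorm (v : rseq R) : \bar R := (\sum_(0 <= i <oo) (v i ^+ 2)%:E)%E.

Definition l2 : set (rseq R) := [set v | (sqnorm v < +oo)%E].

Definition sobolev_ellipsoid (a B : R) : set (rseq R) :=
  [set v | l2 v /\
    (\sum_(0 <= i <oo) (i.+1%:R `^ (2 * a) * v i ^+ 2)%:E <= (B ^+ 2)%:E)%E].

(* [normal_prob] is parametrised by the standard deviation. *)
Definition is_gauss_seq (eps : R) (P : rseq R -> probability (rseq R) R) :=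
  forall th, l2 th -> is_product_law (fun i => normal_prob (th i) eps) (P th).

Definition sieve_sd (eps : R) (d : nat) (a : R) (i : nat) : R :=
  Num.sqrt (eps ^+ 2 * d%:R `^ (2 * a + 1) * i.+1%:R `^ (- (2 * a + 1))).

(* S(.|d,a) *)
Definition sieve_prior (eps : R) (d : nat) (a : R) : probability (rseq R) R :=
  finite_product_law (fun i => normal_prob 0 (sieve_sd eps d a i)) d.

(* The mass at [n] of the distribution on {1, 2, ...} proportional to
   exp (- h n). *)
Definition exp_weight (h : R) (n : nat) : R :=
  expR (- (h * n%:R)) / fine (\sum_(1 <= j <oo) (expR (- (h * j%:R)))%:E)%E.

Lemma exp_weight_ge0 h n : 0 <= exp_weight h n.
Proof.
by rewrite /exp_weight divr_ge0 ?expR_ge0// fine_ge0// nneseries_ge0.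
Qed.

Definition exp_mixture (h : R) (mu : nat -> {measure set (rseq R) -> \bar R}) :
    {measure set (rseq R) -> \bar R} :=
  mseries (fun n => mscale (NngNum (exp_weight_ge0 h n)) (mu n)) 1.

Definition prior (eps eta gamma : R) : {measure set (rseq R) -> \bar R} :=
  exp_mixture gamma (fun k =>
    exp_mixture eta (fun d => sieve_prior eps d k%:R)).

(* [L th] is a version of the density dP_th/dP_0 for every [th] in l_2, chosen
   jointly measurably in the parameter and the observation.  By Fubini, the
   choice changes the posterior only on a P_0-null set of observations. *)
Definition is_likelihood (P : rseq R -> probability (rseq R) R)
    (L : rseq R -> rseq R -> \bar R) :=
  [/\ forall th x, (0 <= L th x)%E,
      measurable_fun [set: rseq R * rseq R] (fun p => L p.1 p.2) &
      forall th, l2 th -> forall A, measurable A ->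
        P th A = (\int[P (fun=> 0%R)]_(x in A) L th x)%E].

(* The junk values of the quotient (denominator 0 or +oo) only occur on a
   P_0-null set of observations. *)
Definition posterior (L : rseq R -> rseq R -> \bar R)
    (Pi : {measure set (rseq R) -> \bar R}) (A : set (rseq R)) (x : rseq R) :
    \bar R :=
  ((\int[Pi]_(th in A) L th x) / (\int[Pi]_th L th x))%E.

End model.

(* Main.v *)
From HB Require Import structures.
Require Import Defs.
From mathcomp Require Import all_boot all_order all_algebra.
From mathcomp Require Import all_classical all_reals all_analysis.
From mathcomp Require Import measurable_realfun.
From mathcomp Require Import ring lra.
Set Implicit Arguments.
Unset Strict Implicit.
Unset Printing Implicit Defensive.
Import Order.TTheory GRing.Theory Num.Theory.
Import numFieldNormedType.Exports.
Local Open Scope classical_set_scope.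
Local Open Scope ring_scope.

(** Write n for (B / eps) ^ (2 / (2 alpha0 + 1)).  The squared radius in the
    theorem is then C eps^2 n, so the claim is that the posterior puts mass at
    most exp (- n) outside a ball of squared radius C eps^2 n.

    The prior is a countable mixture, with weights w(k, d), of Gaussian laws
    S(k, d) that live on the first d coordinates.  The posterior mass of a set A
    is a sum over (k, d) of ratios w(k, d) a(k, d) / D, where a(k, d) is the
    integral over A of the likelihood under S(k, d), and D the same
    weighted sum of the full integrals.  Each ratio is at most 1, and it is also at most
    w(k, d) a(k, d) / (w(k0, d0) m), where m is the full integral for one fixed
    pair (k0, d0); hence it is at most the square root of the latter
    ([mixture_ratio_le]).  This square root is what makes the argument work
    without tests or entropy bounds: it is integrable under the true law,
    however far the component (k, d) is from the truth.

    Everything else is explicit.  Beyond N >= d0 the tail of th0 has squared norm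
    at most eps^2 n.  On the far set the indicator is therefore at most
    exp ((s / eps^2 - (C - 1) n) / 16), where s is the squared distance from th to
    th0 on the first N coordinates ([numerator_le]), and a(k, d) is bounded by a
    product over the coordinates of one-dimensional Gaussian integrals
    ([sieve_evidence]); m is such a product too.  The expectation of the square
    root of the ratio is therefore a product of one-dimensional Gaussian
    integrals ([half_moment_le]).  A coordinate beyond d0 contributes at most
    exp ((th0_i / eps)^2), with no multiplicative constant, because by the
    Cauchy-Schwarz inequality the half moment of a likelihood ratio is at most 1,
    with enough room to absorb the factor 1 / 16 ([half_evidence_ratio_out]).  A
    coordinate i below d0 costs a constant, a quarter of the logarithm of its
    prior variance ratio V_i, and (th0_i / eps)^2 / V_i
    ([half_evidence_ratio_in]).

    With d0 of order n and k0 at least alpha0, the sum of the logarithms is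
    O(d0), by Stirling, and the terms in th0 add up to at most n on the
    ellipsoid ([ellipsoid_sum_le]).  So the (k, d) term is at most
    exp (O(n) - (C - 1) n / 32) times a geometric factor in k and in d.  Summing
    over (k, d) and taking C large concludes, even for n close to 1, since the
    constants are absorbed into exp (O(n)).

    The likelihood is only given up to null sets.  For th with finitely many
    nonzero coordinates the law P th has an explicit density with respect to
    P 0, by uniqueness of product laws ([gauss_density]); Fubini then replaces
    the given likelihood by this density in all the integrals against the
    components of the prior, for almost every observation
    ([marginal_likelihood_ae]). *)

(** * Complements on integrals and series *)

Lemma integral_mkindic d (T : measurableType d) (R : realType)
    (mu : {measure set T -> \bar R}) (A : set T) (f : T -> \bar R) :
  (\int[mu]_(x in A) f x = \int[mu]_x (f x * (\1_A x)%:E))%E.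
Proof.
rewrite integral_mkcond; apply: eq_integral => x _.
by rewrite patchE indicE; case: ifP => _; rewrite ?mule1 ?mule0.
Qed.

Lemma fubini_tonelli_in d1 d2 (T1 : measurableType d1) (T2 : measurableType d2)
    (R : realType)
    (m1 : probability T1 R) (m2 : probability T2 R) (f : T1 * T2 -> \bar R) E :
  measurable_fun setT f -> (forall p, 0 <= f p)%E -> measurable E ->
  measurable_fun setT (fun y => \int[m2]_(x in E) f (y, x))%E /\
  (\int[m2]_(x in E) \int[m1]_y f (y, x) =
   \int[m1]_y \int[m2]_(x in E) f (y, x))%E.
Proof.
move=> mf f0 mE.
pose g (p : T1 * T2) := (f p * (\1_E p.2)%:E)%E.
have mg : measurable_fun setT g.
  apply: emeasurable_funM => //; apply/measurable_EFinP.
  by apply: (measurableT_comp (measurable_indic mE)); exact: measurable_snd.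
have g0 p : (0 <= g p)%E by rewrite mule_ge0.
split.
  rewrite (_ : (fun y => _) = fubini_F m2 g).
    exact: measurable_fun_fubini_tonelli_F.
  by apply/funext => y; rewrite /fubini_F [LHS]integral_mkindic.
transitivity (\int[m2]_x \int[m1]_y g (y, x))%E.
  rewrite [LHS]integral_mkindic; apply: eq_integral => x _.
  rewrite -ge0_integralZr//.
  by apply: (measurableT_comp mf); exact: measurable_pair2.
rewrite -fubini_tonelli//; apply: eq_integral => y _.
by rewrite [RHS]integral_mkindic.
Qed.

(** Only the larger function has to be measurable, because the integral of a
    nonnegative function is a supremum over the simple functions below it.  This
    avoids proving that the posterior, a quotient with junk values, is
    measurable. *)
Lemma ae_le_integral d (T : measurableType d) (R : realType)
    (mu : {measure set T -> \bar R}) (f h : T -> \bar R) :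
  (forall x, 0 <= f x)%E -> (forall x, 0 <= h x)%E -> measurable_fun setT h ->
  {ae mu, forall x, (f x <= h x)%E} -> (\int[mu]_x f x <= \int[mu]_x h x)%E.
Proof.
move=> f0 h0 mh [N [mN muN fhN]].
(* Raising h to +oo on the null set makes the inequality hold everywhere. *)
pose h' x := if x \in N then +oo%E else h x.
have h'0 x : (0 <= h' x)%E by rewrite /h'; case: ifP.
have mh' : measurable_fun setT h'.
  apply: measurable_fun_if => //.
    apply: (measurable_fun_bool true); rewrite setTI.
    rewrite (_ : _ @^-1` _ = N)//; apply/seteqP; split => x /=.
      by rewrite -[_ = true]/(is_true _) inE.
    by move=> Nx; apply: mem_set.
  exact: measurable_funTS.
rewrite [leRHS](_ : _ = \int[mu]_x h' x)%E; last first.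
  apply: ge0_ae_eq_integral => //; exists N; split => // x /= hx.
  apply: contrapT => xN; apply: hx => _; rewrite /h' memNset//.
rewrite ge0_integralTE// ge0_integralTE//; apply: ereal_sup_le => _ [s sf <-].
exists s => // x; apply: le_trans (sf x) _; rewrite /h'; case: ifPn => xN.
  exact: leey.
apply: contrapT => fh; move/negP: xN; apply; rewrite inE; exact: fhN.
Qed.

Lemma nneseries_term_le (R : realType) (f : nat -> \bar R) n : (forall k, 0 <= f k)%E ->
  (f n <= \sum_(0 <= k <oo) f k)%E.
Proof.
by move=> f0; rewrite (nneseriesD1 (n := n))// leeDl//; exact: nneseries_ge0.
Qed.

Lemma prode_expR_le (R : realType) N (F : nat -> \bar R) (b : nat -> R) :
  (forall i, 0 <= F i)%E -> (forall i, F i <= (expR (b i))%:E)%E ->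
  (\prod_(i < N) F i <= (expR (\sum_(i < N) b i))%:E)%E.
Proof.
move=> F0 Fb; elim: N => [|N IH]; first by rewrite !big_ord0 expR0.
rewrite !big_ord_recr/= expRD EFinM; apply: lee_pmul => //.
by apply: prode_ge0.
Qed.

(** * Product laws on sequences *)
Section product_law_theory.
Context (R : realType).
Implicit Types (nu : nat -> probability (measurableTypeR R) R).

Definition rectangle (n : nat) (U : nat -> set R) : set (rseq R) :=
  [set x | forall i, (i < n)%N -> U i (x i)].

Lemma rectangle_bigcap n (U : nat -> set R) :
  rectangle n U =
  \bigcap_(i in [set i | (i < n)%N]) ((fun x : rseq R => x i) @^-1` U i).
Proof. by apply/seteqP; split => x /= h i; exact: h. Qed.

Lemma measurable_rectangle n U :
  (forall i, measurable (U i)) -> measurable (rectangle n U).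
Proof.
move=> mU; rewrite rectangle_bigcap.
apply: fin_bigcap_measurable => [|i _]; first exact: finite_II.
by rewrite -[X in measurable X]setTI; exact: measurable_coord.
Qed.

Lemma rectangle_widen n m (U : nat -> set R) : (n <= m)%N ->
  rectangle n U = rectangle m (fun i => if (i < n)%N then U i else setT).
Proof.
move=> nm; apply/seteqP; split => x /= h i im.
  by case: ifPn => // lt; exact: h.
by have := h i (leq_trans im nm); rewrite im.
Qed.

Definition rectangles : set (set (rseq R)) :=
  [set A | exists n U, (forall i, measurable (U i)) /\ A = rectangle n U].

Lemma rectangles_setI_closed : setI_closed rectangles.
Proof.
move=> _ _ [n [U [mU ->]]] [m [V [mV ->]]].
rewrite (rectangle_widen U (leq_maxl n m)) (rectangle_widen V (leq_maxr n m)).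
exists (maxn n m), (fun i => (if (i < n)%N then U i else setT) `&`
  (if (i < m)%N then V i else setT)); split; last first.
  apply/seteqP; split => [x [h1 h2] i im|x h].
    by split; [exact: h1|exact: h2].
  by split => i im; have [] := h i im.
by move=> i; apply: measurableI; case: ifPn.
Qed.

Lemma measurable_rectangles : @measurable _ (rseq R) = <<s rectangles >>.
Proof.
apply/seteqP; split; last first.
  apply: smallest_sub; first exact: sigma_algebra_measurable.
  by move=> _ [n [U [mU ->]]]; exact: measurable_rectangle.
apply: smallest_sub; first exact: smallest_sigma_algebra.
move=> _ [i [U mU ->]]; apply: sub_gen_smallest.
exists i.+1, (fun j => if j == i then U else setT); split.
  by move=> j; case: ifPn.
apply/seteqP; split => x /=.
  by move=> Ux j _; case: eqVneq => // ->.
by move=> /(_ i (ltnSn i)); rewrite eqxx.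
Qed.

(** Rectangles form a pi-system that generates the sigma-algebra. *)
Lemma rectangles_unique (P Q : {measure set (rseq R) -> \bar R}) :
  (P setT < +oo)%E ->
  (forall n U, (forall i, measurable (U i)) ->
    P (rectangle n U) = Q (rectangle n U)) ->
  forall A, measurable A -> P A = Q A.
Proof.
move=> Pfin PQ A mA.
apply: (measure_unique rectangles (fun=> setT) measurable_rectangles
  rectangles_setI_closed) => //.
- move=> _; exists 0%N, (fun=> setT); split => //.
  by apply/seteqP; split.
- by apply/seteqP; split => // x _; exists 0%N.
- by move=> _ [n [U [mU ->]]]; exact: PQ.
Qed.

(** Truncating a sequence turns any product law into the finite product law with
    the same first marginals, over which one can integrate by induction. *)
Definition trunc (n : nat) (x : rseq R) : rseq R :=
  fun i => if (i < n)%N then x i else 0.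

Lemma measurable_trunc n : measurable_fun setT (trunc n).
Proof.
apply: measurable_to_rseq => i; rewrite /trunc /coord.
by case: (ltnP i n) => _; [exact: measurable_coord|exact: measurable_cst].
Qed.

HB.instance Definition _ n := isMeasurableFun.Build _ _ _ _ (trunc n)
  (@measurable_trunc n).

Lemma trunc_law nu (P : probability (rseq R) R) n : is_product_law nu P ->
  forall A, measurable A ->
    distribution P (trunc n) A = finite_product_law nu n A.
Proof.
move=> Pnu; apply: rectangles_unique => [|m U mU].
  by rewrite (le_lt_trans (probability_le1 _ _))// ltry.
rewrite [RHS](finite_product_lawP nu n m mU).
transitivity (P (trunc n @^-1` rectangle m U)) => //.
have [U0|] := pselect (forall i, (n <= i < m)%N -> U i 0); last first.
  move=> /existsNP[i /not_implyP[/andP[ni im] Ui0]].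
  rewrite (_ : trunc n @^-1` rectangle m U = set0); last first.
    apply/seteqP; split => // x /= /(_ i im).
    by rewrite /trunc /coord ltnNge ni.
  rewrite measure0 (bigD1 (Ordinal im))//= ltnNge ni/= diracE memNset//.
  by rewrite mul0e.
(* All the U i with n <= i < m contain 0, the value that truncation puts there. *)
pose V i := if (i < n)%N then U i else setT.
have mV i : measurable (V i) by rewrite /V; case: ifP.
rewrite (_ : trunc n @^-1` rectangle m U = rectangle m V); last first.
  apply/seteqP; split => x /= h i im; have := h i im; rewrite /V /trunc /coord.
    by case: ifPn.
  by case: ltnP => // ni _; apply: U0; rewrite ni.
rewrite [LHS](Pnu m V mV); apply: eq_bigr => i _; rewrite /V.
case: ltnP => ni //.
rewrite [LHS]probability_setT [RHS]diracE mem_set//.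
by apply: U0; rewrite ni ltn_ord.
Qed.

Lemma integral_finite_product_law nu n (phi : nat -> R -> R) :
  (forall i, measurable_fun setT (phi i)) -> (forall i t, 0 <= phi i t) ->
  (\int[finite_product_law nu n]_x (\prod_(i < n) phi i (x i))%:E =
   \prod_(i < n) \int[nu i]_t (phi i t)%:E)%E.
Proof.
move=> mphi phi0.
have mprod m : measurable_fun [set: rseq R]
    (fun x : rseq R => \prod_(i < m) phi i (x i)).
  apply: measurable_prod => i _.
  by apply: measurableT_comp; [exact: mphi|exact: measurable_coord].
have prod0 m (x : rseq R) : 0 <= \prod_(i < m) phi i (x i).
  by apply: prodr_ge0 => i _; exact: phi0.
elim: n => [|n IH].
  under eq_integral do rewrite big_ord0.
  by rewrite big_ord0 integral_cst//= diracT mule1.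
rewrite ge0_integral_distribution//; last 2 first.
  by apply/measurable_EFinP; exact: mprod.
  by move=> y; rewrite lee_fin.
under eq_integral => p _.
  rewrite /comp big_ord_recr/= /coord /set_coord eqxx.
  rewrite (eq_bigr (fun i : 'I_n => phi i (p.1 i))); last first.
    by move=> i _; rewrite (ltn_eqF (ltn_ord i)).
  over.
rewrite fubini_tonelli1; last 2 first.
- apply/measurable_EFinP; apply: measurable_funM.
    by apply: (measurableT_comp (mprod n)); exact: measurable_fst.
  by apply: (measurableT_comp (mphi n)); exact: measurable_snd.
- by move=> p; rewrite lee_fin; apply: mulr_ge0; [exact: prod0|exact: phi0].
rewrite big_ord_recr/= -IH -ge0_integralZr//; last 3 first.
- by apply/measurable_EFinP; exact: mprod.
- by move=> x _; rewrite lee_fin.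
- by apply: integral_ge0 => t _; rewrite lee_fin.
apply: eq_integral => x _; rewrite /fubini_F/=.
under eq_integral do rewrite EFinM.
rewrite ge0_integralZl//.
- by apply/measurable_EFinP; exact: mphi.
- by move=> t _; rewrite lee_fin; exact: phi0.
- by rewrite lee_fin; exact: prod0.
Qed.

(** The computational tool of the proof: used for the law of the observation and,
    by [finite_product_lawP], for the components of the prior. *)
Lemma integral_product_law nu (P : probability (rseq R) R) n
    (phi : nat -> R -> R) : is_product_law nu P ->
  (forall i, measurable_fun setT (phi i)) -> (forall i t, 0 <= phi i t) ->
  (\int[P]_x (\prod_(i < n) phi i (x i))%:E =
   \prod_(i < n) \int[nu i]_t (phi i t)%:E)%E.
Proof.
move=> Pnu mphi phi0; rewrite -integral_finite_product_law//.
transitivity (\int[distribution P (trunc n)]_x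
    (\prod_(i < n) phi i (x i))%:E)%E; last first.
  by apply: eq_measure_integral => A mA _; exact: trunc_law.
rewrite ge0_integral_distribution//; last 2 first.
- apply/measurable_EFinP; apply: measurable_prod => i _.
  by apply: measurableT_comp; [exact: mphi|exact: measurable_coord].
- by move=> y; rewrite lee_fin prodr_ge0.
apply: eq_integral => x _ /=; congr (_%:E); apply: eq_bigr => i _.
by rewrite /trunc /coord ltn_ord.
Qed.

End product_law_theory.

(** * Densities and Gaussian integrals *)
Section density.
Context d (T : measurableType d) (R : realType).
Variables (mu : {measure set T -> \bar R}) (g : T -> R).
Hypotheses (mg : measurable_fun setT g) (g0 : forall x, 0 <= g x).

Definition density_measure (A : set T) : \bar R := (\int[mu]_(x in A) (g x)%:E)%E.

Let density0 : density_measure set0 = 0%E.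
Proof. by rewrite /density_measure integral_set0. Qed.

Let density_ge0 A : (0 <= density_measure A)%E.
Proof. by apply: integral_ge0 => x _; rewrite lee_fin. Qed.

Let density_sigma_additive : semi_sigma_additive density_measure.
Proof.
move=> /= F mF tF mUF; rewrite /density_measure; apply: cvg_toP.
  apply: ereal_nondecreasing_is_cvgn => m n mn.
  apply: lee_sum_nneg_natr => // k _ _.
  by apply: integral_ge0 => x _; rewrite lee_fin.
rewrite ge0_integral_bigcup//=.
- by apply: measurable_funTS; exact/measurable_EFinP.
- by move=> x _; rewrite lee_fin.
Qed.

Definition density_law : {measure set T -> \bar R} :=
  HB.pack density_measure (isMeasure.Build _ _ _ density_measure density0
    density_ge0 density_sigma_additive).

End density.

Section density_integral.
Context d (T : measurableType d) (R : realType).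
Variables (mu : {sigma_finite_measure set T -> \bar R})
  (nu : {finite_measure set T -> \bar R}).

(** A Radon-Nikodym derivative obeys this change of variables, and the density g
    is almost everywhere equal to it. *)
Lemma ge0_integral_density (g f : T -> \bar R) :
  measurable_fun setT g -> (forall x, 0 <= g x)%E ->
  (forall A, measurable A -> nu A = \int[mu]_(x in A) g x)%E ->
  measurable_fun setT f -> (forall x, 0 <= f x)%E ->
  (\int[nu]_x f x = \int[mu]_x (f x * g x))%E.
Proof.
move=> mg g0 nug mf f0.
have numu : nu `<< mu.
  apply/null_content_dominatesP => A mA A0; rewrite nug//.
  by apply: null_set_integral => //; exact: measurable_funTS.
rewrite -(Radon_Nikodym_SigmaFinite.change_of_variables numu f0)//.
have RNi := Radon_Nikodym_SigmaFinite.f_integrable numu.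
have [RN0 RNE] := (Radon_Nikodym_SigmaFinite.f_ge0 numu,
  Radon_Nikodym_SigmaFinite.f_integral numu).
set h := Radon_Nikodym_SigmaFinite.f nu mu in RNi RN0 RNE *.
have mh : measurable_fun setT h by exact: measurable_int RNi.
apply: ge0_ae_eq_integral => //.
- exact: emeasurable_funM.
- exact: emeasurable_funM.
- by move=> x _; exact: mule_ge0.
- by move=> x _; exact: mule_ge0.
have := @integral_ae_eq _ _ _ mu setT measurableT g h RNi mg.
case; first by move=> E _ mE; rewrite -RNE// nug.
move=> N [mN N0 hN]; exists N; split => // x /= hx; apply: hN => /=.
by move=> e; apply: hx => _; rewrite e.
Qed.

End density_integral.

Section gaussian_integral.
Context (R : realType).
Implicit Types a b c m s t : R.

Lemma measurable_expR_quadratic a b c :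
  measurable_fun [set: R] (fun t => expR (a * t ^+ 2 + b * t + c)).
Proof.
apply: measurableT_comp => //.
apply: measurable_funD => //; apply: measurable_funD; apply: measurable_funM => //.
Qed.

(** Completing the square: the integrand times the density of N(m, s^2) is a
    multiple of the density of N((m + b s^2) / k, s^2 / k), where
    k = 1 - 2 a s^2. *)
Lemma normal_exp_quadratic a b c m s : 0 < s -> 0 < 1 - 2 * a * s ^+ 2 ->
  (\int[normal_prob m s]_t (expR (a * t ^+ 2 + b * t + c))%:E =
   (expR (c - ln (1 - 2 * a * s ^+ 2) / 2 +
     (m ^+ 2 * a + b * m + b ^+ 2 * s ^+ 2 / 2) / (1 - 2 * a * s ^+ 2)))%:E)%E.
Proof.
set k := 1 - 2 * a * s ^+ 2 => s0 k0.
rewrite (@ge0_integral_density _ _ _ lebesgue_measure (normal_prob m s)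
  (EFin \o normal_pdf m s))//; last 3 first.
- by apply/measurable_EFinP; exact: measurable_normal_pdf.
- by move=> x; rewrite lee_fin normal_pdf_ge0.
- by apply/measurable_EFinP; exact: measurable_expR_quadratic.
set K := expR _.
have sk0 : 0 < Num.sqrt k by rewrite sqrtr_gt0.
have s'0 : 0 < s / Num.sqrt k by rewrite divr_gt0.
transitivity (\int[lebesgue_measure]_x
  (K%:E * (normal_pdf ((m + b * s ^+ 2) / k) (s / Num.sqrt k) x)%:E))%E; last first.
  rewrite ge0_integralZl//=.
  - by rewrite integral_normal_pdf mule1.
  - by apply/measurable_EFinP; exact: measurable_normal_pdf.
  - by move=> x _; rewrite lee_fin normal_pdf_ge0.
  - by rewrite lee_fin expR_ge0.
apply: eq_integral => x _ /=; rewrite -!EFinM; congr (_%:E).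
rewrite !normal_pdfE ?gt_eqF//.
have -> : normal_peak (s / Num.sqrt k) = normal_peak s * Num.sqrt k.
  rewrite /normal_peak expr_div_n sqr_sqrtr ?ltW// -[in RHS](invrK (Num.sqrt k)).
  rewrite -invfM; congr (_^-1).
  rewrite -sqrtrV ?ltW// -sqrtrM; first by congr Num.sqrt; rewrite mulrAC mulrnAl.
  by rewrite mulrn_wge0// mulr_ge0 ?sqr_ge0 ?pi_ge0.
rewrite /K.
have -> : expR (c - ln k / 2 + (m ^+ 2 * a + b * m + b ^+ 2 * s ^+ 2 / 2) / k) =
    expR (c + (m ^+ 2 * a + b * m + b ^+ 2 * s ^+ 2 / 2) / k) / Num.sqrt k.
  have -> : Num.sqrt k = expR (ln k / 2).
    apply/eqP; rewrite -(@eqrXn2 _ 2)// ?expR_ge0 ?ltW//.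
    by rewrite sqr_sqrtr ?ltW// -expRM_natl mulrC divfK// lnK// posrE.
  by rewrite -expRN -expRD; congr expR; ring.
have nf : expR (a * x ^+ 2 + b * x + c) * normal_fun m s x =
    expR (c + (m ^+ 2 * a + b * m + b ^+ 2 * s ^+ 2 / 2) / k) *
    normal_fun ((m + b * s ^+ 2) / k) (s / Num.sqrt k) x.
  rewrite /normal_fun -!expRD expr_div_n sqr_sqrtr ?ltW//; congr expR.
  move: k0; rewrite /k => k0; field.
  by rewrite !gt_eqF//= ?mulr_gt0// subr_gt0 -subr_gt0.
rewrite mulrCA nf; field.
by rewrite gt_eqF.
Qed.

End gaussian_integral.

(** * One coordinate *)
Section one_coordinate.
Context (R : realType) (eps : R).
Hypothesis eps0 : 0 < eps.
Implicit Types l T S t x s : R.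

(** The logarithm of the integral of
    exp (l (th - t)^2 / eps^2) * exp ((th x - th^2 / 2) / eps^2)
    against the prior N(0, eps^2 T) of one coordinate, see [normal_evidence]; the
    second factor is the likelihood ratio of N(th, eps^2) to N(0, eps^2) at x.
    For l = 0 this is the log evidence of the observation x.  The formula stays
    correct for T = 0, where the prior is the point mass at 0. *)
Definition log_evidence l T t x : R :=
  l * t ^+ 2 / eps ^+ 2 - ln (1 + T * (1 - 2 * l)) / 2 +
  (x - 2 * l * t) ^+ 2 * T / (2 * eps ^+ 2 * (1 + T * (1 - 2 * l))).

Lemma log_evidence0 l t x : log_evidence l 0 t x = l * t ^+ 2 / eps ^+ 2.
Proof. by rewrite /log_evidence mul0r addr0 ln1 mulr0 !mul0r subr0 addr0. Qed.

Lemma normal_evidence l T t x s : 0 < s -> s ^+ 2 = eps ^+ 2 * T -> 2 * l < 1 ->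
  (\int[normal_prob 0 s]_th
     (expR (l * (th - t) ^+ 2 / eps ^+ 2 + (th * x - th ^+ 2 / 2) / eps ^+ 2))%:E
   = (expR (log_evidence l T t x))%:E)%E.
Proof.
move=> s0 sT l1.
have T0 : 0 < T by rewrite -(pmulr_rgt0 _ (exprn_gt0 2 eps0)) -sT exprn_gt0.
have k0 : 0 < 1 + T * (1 - 2 * l) by rewrite ltr_wpDr// mulr_ge0 ?ltW// subr_gt0.
have e0 : eps != 0 by rewrite gt_eqF.
have kE : 1 - 2 * ((l - 1 / 2) / eps ^+ 2) * s ^+ 2 = 1 + T * (1 - 2 * l).
  by rewrite sT; field.
under eq_integral => th _.
  rewrite (_ : _ + _ = (l - 1 / 2) / eps ^+ 2 * th ^+ 2 +
    (x - 2 * l * t) / eps ^+ 2 * th + l * t ^+ 2 / eps ^+ 2); last by field.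
  over.
rewrite normal_exp_quadratic//; last by rewrite kE.
rewrite kE; congr (expR _)%:E; rewrite /log_evidence sT; field.
by rewrite e0/= gt_eqF.
Qed.

(** The half moment of the ratio of a tilted evidence, with prior variance
    eps^2 T and tilt 1 / 16, to an evidence with prior variance eps^2 S.  The
    exponent is quadratic in the observation. *)
Lemma normal_half_evidence_ratio T S t : 0 <= T -> 0 <= S ->
  let p := T / (1 + 7 / 8 * T) in let q := S / (1 + S) in
  let k := 1 - (p - q) / 2 in 0 < k ->
  (\int[normal_prob t eps]_x
     (expR ((log_evidence (1 / 16) T t x - log_evidence 0 S t x) / 2))%:E
   = (expR ((ln (1 + S) - ln (1 + 7 / 8 * T)) / 4 - ln k / 2 +
       (1 / 32 + 45 / 256 * p - 15 / 64 * q + p * q / 512) / k *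
       (t / eps) ^+ 2))%:E)%E.
Proof.
move=> T0 S0 p q k k0.
have e0 : eps != 0 by rewrite gt_eqF.
have hT : 1 + 7 / 8 * T != 0 by rewrite gt_eqF// ltr_wpDr// mulr_ge0.
have hS : 1 + S != 0 by rewrite gt_eqF// ltr_wpDr.
have lT x : log_evidence (1 / 16) T t x = t ^+ 2 / (16 * eps ^+ 2)
    - ln (1 + 7 / 8 * T) / 2 + (x - t / 8) ^+ 2 * p / (2 * eps ^+ 2).
  rewrite /log_evidence (_ : 1 + T * _ = 1 + 7 / 8 * T); last by field.
  rewrite /p; field; rewrite e0/=.
  by apply: contra hT => /eqP h; apply/eqP; lra.
have lS x : log_evidence 0 S t x =
    - ln (1 + S) / 2 + x ^+ 2 * q / (2 * eps ^+ 2).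
  rewrite /log_evidence (_ : 1 + S * _ = 1 + S); last by field.
  by rewrite /q; field; rewrite e0/=.
have kE : 1 - 2 * ((p - q) / (4 * eps ^+ 2)) * eps ^+ 2 = k by rewrite /k; field.
under eq_integral => x _.
  rewrite (_ : _ / 2 = (p - q) / (4 * eps ^+ 2) * x ^+ 2 +
    (- t * p / (16 * eps ^+ 2)) * x + (t ^+ 2 / (32 * eps ^+ 2)
      + (ln (1 + S) - ln (1 + 7 / 8 * T)) / 4
      + t ^+ 2 * p / (256 * eps ^+ 2))); last first.
    by rewrite lT lS; field.
  over.
rewrite normal_exp_quadratic//; last by rewrite kE.
rewrite kE; congr (expR _)%:E.
have k0' : k != 0 by rewrite gt_eqF.
suff : t ^+ 2 / (32 * eps ^+ 2) + t ^+ 2 * p / (256 * eps ^+ 2) +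
    (t ^+ 2 * ((p - q) / (4 * eps ^+ 2)) + - t * p / (16 * eps ^+ 2) * t +
     (- t * p / (16 * eps ^+ 2)) ^+ 2 * eps ^+ 2 / 2) / k =
    (1 / 32 + 45 / 256 * p - 15 / 64 * q + p * q / 512) / k * (t / eps) ^+ 2.
  move=> <-; ring.
have kk : 2 - p + q = 2 * k by rewrite /k; field.
have -> : (1 / 32 + 45 / 256 * p - 15 / 64 * q + p * q / 512) =
  (1 / 32 + p / 256) * k + (p - q) / 4 - p / 16 + p ^+ 2 / 512.
  by rewrite /k; field.
by field; rewrite k0' e0.
Qed.

Let shrink_le T : 0 <= T -> 0 <= T / (1 + 7 / 8 * T) <= 8 / 7.
Proof.
move=> T0; have k0 : 0 < 1 + 7 / 8 * T by lra.
apply/andP; split; first by rewrite divr_ge0// ltW.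
by rewrite ler_pdivrMr//; lra.
Qed.

Let ln_le_sub1 x : 0 < x -> ln x <= x - 1.
Proof.
by move=> x0; rewrite -[in leLHS](subrK 1 x) addrC; apply: le_ln1Dx; lra.
Qed.

Let ln_ge_1subV x : 0 < x -> - ln x <= x^-1 - 1.
Proof. by move=> x0; rewrite -lnV ?posrE//; apply: ln_le_sub1; rewrite invr_gt0. Qed.

(** A coordinate on which the reference component of the prior is Gaussian.  The
    coefficient of (t / eps)^2 has to vanish as S grows: its numerator is affine
    in q = S / (1 + S), at the extreme value p = 8 / 7 it equals
    13 / 56 (1 - q), and 1 - q = 1 / (1 + S). *)
Lemma half_evidence_ratio_in T S t : 0 <= T -> 1 <= S ->
  (\int[normal_prob t eps]_x
     (expR ((log_evidence (1 / 16) T t x - log_evidence 0 S t x) / 2))%:E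
   <= (expR (1 + ln S / 4 + (t / eps) ^+ 2 / S))%:E)%E.
Proof.
move=> T0 S1; have S0 : 0 < S by lra.
have /andP[] := shrink_le T0.
set p := T / _ => p0 p1.
have qE : S / (1 + S) = 1 - (1 + S)^-1 by field; rewrite gt_eqF//; lra.
have q0 : (1 + S)^-1 <= 1 / 2 by rewrite -[leRHS]invrK lef_pV2 ?posrE ?invr_gt0; lra.
have q1 : 0 < (1 + S)^-1 by rewrite invr_gt0; lra.
have k0 : 19 / 28 <= 1 - (p - S / (1 + S)) / 2 by rewrite qE; lra.
rewrite normal_half_evidence_ratio//; [|exact: ltW|by rewrite -/p; lra].
rewrite lee_fin ler_expR -/p.
set k := 1 - _ in k0 *; set N := 1 / 32 + _ - _ + _.
have ln1S : ln (1 + S) <= 1 + ln S.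
  apply: (@le_trans _ _ (ln (2 * S))).
    by rewrite ler_ln ?posrE; lra.
  by rewrite lnM ?posrE// lerD2r; apply: le_trans (ln_le_sub1 _) _; lra.
have lnT : 0 <= ln (1 + 7 / 8 * T) by apply: ln_ge0; lra.
have lnk : - ln k <= 1.
  apply: le_trans (ln_ge_1subV _) _; first by lra.
  suff : k^-1 <= 2 by lra.
  by rewrite -[leRHS]invrK lef_pV2 ?posrE ?invr_gt0; lra.
have Nk : N / k <= S^-1.
  rewrite ler_pdivrMr; last by lra.
  apply: (@le_trans _ _ ((1 + S)^-1 * k)); last first.
    by rewrite ler_pM2r ?lef_pV2 ?posrE; lra.
  rewrite /N qE; set r := (1 + S)^-1 in q0 q1 *.
  have pr : 0 <= (8 / 7 - p) * r by rewrite mulr_ge0; lra.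
  have kr : 0 <= (k - 19 / 28) * r by rewrite mulr_ge0; lra.
  by nra.
have u2 : 0 <= (t / eps) ^+ 2 by exact: sqr_ge0.
have := ler_wpM2r u2 Nk.
rewrite [S^-1 * _]mulrC; lra.
Qed.

(** A coordinate on which the reference component is the point mass at 0.  No
    constant factor may appear, since there is no bound on the number of such
    coordinates.  For k = 1 - p / 2 this amounts to (1 + 7 / 8 T) k^2 >= 1, that
    is (1 + 3 / 8 T)^2 >= 1 + 7 / 8 T, which holds for T >= 8 / 9 and T = 0 but
    fails in between: the prior variances must not be much smaller than that of
    the noise. *)
Lemma half_evidence_ratio_out T t : T = 0 \/ 1 <= T ->
  (\int[normal_prob t eps]_x
     (expR ((log_evidence (1 / 16) T t x - log_evidence 0 0 t x) / 2))%:E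
   <= (expR ((t / eps) ^+ 2))%:E)%E.
Proof.
move=> T01; have T0 : 0 <= T by case: T01 => [->//|]; lra.
have /andP[] := shrink_le T0.
set p := T / _ => p0 p1.
rewrite normal_half_evidence_ratio//; last by rewrite mul0r subr0 -/p; lra.
rewrite lee_fin ler_expR -/p mul0r subr0 !mulr0 mul0r subr0 !addr0 ln1 add0r.
set k := 1 - p / 2; have k0 : 3 / 7 <= k by rewrite /k; lra.
have h : 0 < 1 + 7 / 8 * T by lra.
have kE : k = (1 + 3 / 8 * T) / (1 + 7 / 8 * T).
  by rewrite /k /p; field; rewrite gt_eqF//; lra.
have lnkE : 0 <= ln (1 + 7 / 8 * T) / 4 + ln k / 2.
  suff : 0 <= ln ((1 + 7 / 8 * T) * k ^+ 2).
    by rewrite lnM ?posrE// ?exprn_gt0 ?lnXn//; lra.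
  apply: ln_ge0; rewrite kE.
  have -> : (1 + 7 / 8 * T) * ((1 + 3 / 8 * T) / (1 + 7 / 8 * T)) ^+ 2 =
      (1 + 3 / 8 * T) ^+ 2 / (1 + 7 / 8 * T).
    by field; rewrite gt_eqF//; lra.
  rewrite ler_pdivlMr// mul1r.
  by case: T01 => [->|T1]; nra.
have Nk : (1 / 32 + 45 / 256 * p) / k <= 1 by rewrite ler_pdivrMr; lra.
have := ler_wpM2r (sqr_ge0 (t / eps)) Nk.
by rewrite mul1r; lra.
Qed.

End one_coordinate.

(** * Parameters with finitely many nonzero coordinates *)
Section finite_support.
Context (R : realType).
Implicit Types (th x : rseq R) (nu : nat -> probability (measurableTypeR R) R).

Definition supported (d : nat) : set (rseq R) :=
  [set th | forall i, (d <= i)%N -> th i = 0].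

Lemma sqnorm_split (n : nat) (v : rseq R) :
  sqnorm v = ((\sum_(i < n) v i ^+ 2)%:E + \sum_(n <= i <oo) (v i ^+ 2)%:E)%E.
Proof.
rewrite /sqnorm (nneseries_split _ n)//; last first.
  by move=> k _; rewrite lee_fin sqr_ge0.
by rewrite add0n big_mkord sumEFin.
Qed.

Lemma supported_l2 d th : supported d th -> l2 th.
Proof.
move=> sth; rewrite /l2/= (sqnorm_split d) eseries0 ?adde0 ?ltry//.
by move=> i di _; rewrite sth// expr0n.
Qed.

Lemma product_law_coord nu (P : probability (rseq R) R) i U :
  is_product_law nu P -> measurable U -> P [set x | U (x i)] = nu i U.
Proof.
move=> Pnu mU; pose V j := if j == i then U else setT.
rewrite (_ : [set x | _] = rectangle i.+1 V); last first.
  apply/seteqP; split => x /=.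
    by move=> Ux j _; rewrite /V; case: eqVneq => // ->.
  by move=> /(_ i (ltnSn i)); rewrite /V eqxx.
rewrite [LHS]Pnu; last by move=> j; rewrite /V; case: ifP.
rewrite (bigD1 (Ordinal (ltnSn i)))//= /V eqxx big1 ?mule1// => j.
rewrite -val_eqE/= => /negbTE ->; exact: probability_setT.
Qed.

Lemma finite_product_law_supported nu d :
  {ae finite_product_law nu d, forall th, supported d th}.
Proof.
apply: ae_foralln => i.
have [di|di] := leqP d i; last by apply: aeW => x.
have m0 : measurable [set (0 : R)] by exact: measurable_set1.
have mi : measurable [set x : rseq R | [set (0 : R)] (x i)].
  by rewrite -[X in measurable X]setTI; exact: measurable_coord.
exists (~` [set x : rseq R | [set (0 : R)] (x i)]); split.
- exact: measurableC.
- rewrite [LHS]probability_setC//.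
  rewrite (product_law_coord _ (finite_product_lawP nu d))// ltnNge di/=.
  by rewrite indicE mem_set// -EFinD subrr.
- by move=> x /= h xi; apply: h.
Qed.

End finite_support.

Section likelihood.
Context (R : realType) (eps : R).
Hypothesis eps0 : 0 < eps.
Implicit Types (th x t : rseq R).

(** The density of P th with respect to P 0 when th vanishes beyond N. *)
Definition gauss_lik (N : nat) th x : R :=
  expR (\sum_(i < N) (th i * x i - th i ^+ 2 / 2) / eps ^+ 2).

Lemma measurable_gauss_lik N :
  measurable_fun setT (fun p : rseq R * rseq R => gauss_lik N p.1 p.2).
Proof.
apply: measurableT_comp => //; apply: measurable_sum => i.
apply: measurable_funM => //; apply: measurable_funB.
  apply: measurable_funM; apply: (measurableT_comp (measurable_coord i)).
    exact: measurable_fst.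
  exact: measurable_snd.
apply: measurable_funM => //; apply: measurable_funX.
by apply: (measurableT_comp (measurable_coord i)); exact: measurable_fst.
Qed.

Lemma normal_prob_shift (m : R) (U : set R) : measurable U ->
  (\int[normal_prob 0 eps]_x (expR ((m * x - m ^+ 2 / 2) / eps ^+ 2) * \1_U x)%:E
   = normal_prob m eps U)%E.
Proof.
move=> mU; rewrite (@ge0_integral_density _ _ _ lebesgue_measure
  (normal_prob 0 eps) (EFin \o normal_pdf 0 eps))//; last 3 first.
- by apply/measurable_EFinP; exact: measurable_normal_pdf.
- by move=> x; rewrite lee_fin normal_pdf_ge0.
- apply/measurable_EFinP; apply: measurable_funM => //.
  apply: measurableT_comp => //; apply: measurable_funM => //.
  by apply: measurable_funB => //; exact: measurable_funM.
transitivity (\int[lebesgue_measure]_(x in U) (normal_pdf m eps x)%:E)%E => //.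
rewrite [RHS]integral_mkindic; apply: eq_integral => x _.
rewrite /= -!EFinM mulrAC; congr (_ * _)%:E.
rewrite !normal_pdfE ?gt_eqF// mulrCA; congr (_ * _).
rewrite /normal_fun -expRD; congr expR; field.
by rewrite gt_eqF.
Qed.

Variables (P : rseq R -> probability (rseq R) R).
Hypothesis PG : is_gauss_seq eps P.

(** Both sides are measures that agree on rectangles.  A rectangle may involve
    fewer or more than N coordinates, hence the passage to m = maxn n N. *)
Lemma gauss_density N th E : supported N th -> measurable E ->
  P th E = (\int[P (fun=> 0)%R]_(x in E) (gauss_lik N th x)%:E)%E.
Proof.
move=> sth.
have mlik : measurable_fun setT (gauss_lik N th).
  exact: (measurableT_comp (measurable_gauss_lik N) (measurable_pair1 th)).
have lik0 x : 0 <= gauss_lik N th x by exact: expR_ge0.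
move: E; apply: (@rectangles_unique _ (P th)
  (density_law (P (fun=> 0%R)) mlik lik0)) => [|n U mU].
  by rewrite (le_lt_trans (probability_le1 _ _))// ltry.
set m := maxn n N.
rewrite (rectangle_widen U (leq_maxl n N)) -/m.
pose V i := if (i < n)%N then U i else setT; rewrite -/V.
have mV i : measurable (V i) by rewrite /V; case: ifP.
rewrite [LHS](PG (supported_l2 sth))//.
transitivity (\int[P (fun=> 0)%R]_(x in rectangle m V) (gauss_lik N th x)%:E)%E => //.
rewrite integral_mkindic.
under eq_integral => x _.
  rewrite -EFinM (_ : _ * _ = \prod_(i < m)
    (expR ((th i * x i - th i ^+ 2 / 2) / eps ^+ 2) * \1_(V i) (x i))); last first.
    rewrite big_split/=; congr (_ * _).
      rewrite /gauss_lik -expR_sum; congr expR.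
      rewrite (big_ord_widen m (fun i => (th i * x i - th i ^+ 2 / 2) / eps ^+ 2)
        (leq_maxr n N)) big_mkcond/=; apply: eq_bigr => i _.
      case: ltnP => // Ni; rewrite sth//.
      by rewrite mul0r expr0n/= mul0r subr0 mul0r.
    rewrite indicE; case: (boolP (x \in _)) => /=; rewrite ?inE ?notin_setE => xV.
      rewrite big1// => i _; rewrite indicE mem_set//; exact: xV.
    apply/esym/eqP; rewrite prodf_seq_eq0; apply/hasP.
    apply: contrapT => h; apply: xV => i im.
    apply: contrapT => xi; apply: h; exists (Ordinal im) => //=.
      by rewrite mem_index_enum.
    by rewrite indicE memNset.
  over.
rewrite (@integral_product_law _ (fun i => normal_prob 0 eps) _ m
  (fun i y => expR ((th i * y - th i ^+ 2 / 2) / eps ^+ 2) * \1_(V i) y)).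
- by apply: eq_bigr => i _; rewrite normal_prob_shift.
- by apply: PG; exact: (@supported_l2 _ 0).
- move=> i; apply: measurable_funM => //; apply: measurableT_comp => //.
  by apply: measurable_funM => //; apply: measurable_funB => //; exact: measurable_funM.
- by move=> i y; rewrite mulr_ge0 ?expR_ge0.
Qed.


Variables (L : rseq R -> rseq R -> \bar R).
Hypothesis PL : is_likelihood P L.

(** The integrals of both sides over an arbitrary event E of observations are, by
    Tonelli, equal to the integral of P th E over th in A. *)
Lemma marginal_likelihood_ae (S : probability (rseq R) R) N A : measurable A ->
  {ae S, forall th, supported N th} ->
  ae_eq (P (fun=> 0)) setT (fun x => \int[S]_(th in A) L th x)%E
    (fun x => \int[S]_(th in A) (gauss_lik N th x)%:E)%E.
Proof.
move=> mA sN; have [L0 mL dL] := PL; set P0 := P (fun=> 0).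
pose f1 (p : rseq R * rseq R) := (L p.1 p.2 * (\1_A p.1)%:E)%E.
pose f2 (p : rseq R * rseq R) := ((gauss_lik N p.1 p.2)%:E * (\1_A p.1)%:E)%E.
have m1A : measurable_fun setT (fun p : rseq R * rseq R => (\1_A p.1)%:E : \bar R).
  apply/measurable_EFinP.
  by apply: (measurableT_comp (measurable_indic mA)); exact: measurable_fst.
have mf1 : measurable_fun setT f1 by exact: emeasurable_funM.
have mf2 : measurable_fun setT f2.
  apply: emeasurable_funM => //; apply/measurable_EFinP.
  exact: measurable_gauss_lik.
have f10 p : (0 <= f1 p)%E by rewrite mule_ge0.
have f20 p : (0 <= f2 p)%E by rewrite mule_ge0// lee_fin expR_ge0.
rewrite (_ : (fun x => _) = (fun x => \int[S]_th f1 (th, x))%E); last first.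
  by apply/funext => x; rewrite [LHS]integral_mkindic.
rewrite (_ : (fun x => \int[S]_(th in A) _)%E =
    (fun x => \int[S]_th f2 (th, x))%E); last first.
  by apply/funext => x; rewrite [LHS]integral_mkindic.
have inner1 E th : measurable E -> supported N th ->
    (\int[P0]_(x in E) f1 (th, x) = P th E * (\1_A th)%:E)%E.
  move=> mE sth; rewrite /f1/= (dL th (supported_l2 sth) E mE) ge0_integralZr//.
  by apply: measurable_funTS; exact: (measurableT_comp mL (measurable_pair1 th)).
have inner2 E th : measurable E -> supported N th ->
    (\int[P0]_(x in E) f2 (th, x) = P th E * (\1_A th)%:E)%E.
  move=> mE sth; rewrite /f2/= (gauss_density sth mE) ge0_integralZr//.
    apply/measurable_EFinP; apply: measurable_funTS.
    exact: (measurableT_comp (measurable_gauss_lik N) (measurable_pair1 th)).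
  by move=> x _; rewrite lee_fin expR_ge0.
have same E : measurable E -> (\int[P0]_(x in E) \int[S]_th f1 (th, x) =
    \int[P0]_(x in E) \int[S]_th f2 (th, x))%E.
  move=> mE; have [mF1 ->] := fubini_tonelli_in S P0 mf1 f10 mE.
  have [mF2 ->] := fubini_tonelli_in S P0 mf2 f20 mE.
  apply: ge0_ae_eq_integral => //.
  - by move=> th _; exact: integral_ge0.
  - by move=> th _; exact: integral_ge0.
  by apply: filterS sN => th sth _; rewrite inner1// inner2.
apply: integral_ae_eq => //; last first.
- by move=> E _ mE; exact: same.
- exact: (measurable_fun_fubini_tonelli_G f2 mf2 f20).
apply/integrableP; split.
  exact: (measurable_fun_fubini_tonelli_G f1 mf1 f10).
under eq_integral do (rewrite gee0_abs; last by apply: integral_ge0).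
have [mF1 ->] := fubini_tonelli_in S P0 mf1 f10 measurableT.
apply: (@le_lt_trans _ _ (\int[S]_th 1)%E).
  apply: ae_ge0_le_integral => //.
  - by move=> th _; exact: integral_ge0.
  - apply: filterS sN => th sth _; rewrite inner1// probability_setT mul1e.
    by rewrite lee_fin indicE; case: (_ \in _).
by rewrite integral_cst// mul1e (le_lt_trans (probability_le1 _ _))// ltry.
Qed.

End likelihood.

(** * Evidence of the components of the prior *)
Section sieve.
Context (R : realType) (eps : R).
Hypothesis eps0 : 0 < eps.
Implicit Types (th x t : rseq R).

(** The prior variance of a coordinate divided by the noise variance eps^2; the
    value 0 encodes the point mass. *)
Definition var_ratio (d k i : nat) : R :=
  if (i < d)%N then (d%:R / i.+1%:R) `^ (2 * k%:R + 1) else 0.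

Lemma var_ratio_ge1 d k i : (i < d)%N -> 1 <= var_ratio d k i.
Proof.
move=> id; rewrite /var_ratio id.
apply: (@le_trans _ _ (1 `^ (2 * k%:R + 1))); first by rewrite powR1.
have k0 : 0 <= 2 * k%:R + 1 :> R by rewrite addr_ge0// mulr_ge0.
rewrite ge0_ler_powR// ?nnegrE//.
by rewrite ler_pdivlMr ?ltr0n// mul1r ler_nat.
Qed.

Lemma var_ratio_out d k i : (d <= i)%N -> var_ratio d k i = 0.
Proof. by move=> di; rewrite /var_ratio ltnNge di. Qed.

Lemma var_ratio_01 d k i : var_ratio d k i = 0 \/ 1 <= var_ratio d k i.
Proof.
have [di|di] := leqP d i; first by left; exact: var_ratio_out.
by right; exact: var_ratio_ge1.
Qed.

Lemma sieve_sdE d k i : (i < d)%N ->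
  sieve_sd eps d k%:R i ^+ 2 = eps ^+ 2 * var_ratio d k i.
Proof.
move=> id; rewrite /sieve_sd /var_ratio id sqr_sqrtr; last first.
  by apply: mulr_ge0; rewrite ?powR_ge0// mulr_ge0 ?powR_ge0 ?sqr_ge0.
rewrite -mulrA; congr (_ * _).
by rewrite powRM// -?powR_inv1// -powRrM mulN1r.
Qed.

Lemma sieve_sd_gt0 d k i : (i < d)%N -> 0 < sieve_sd eps d k%:R i.
Proof.
move=> id; rewrite /sieve_sd sqrtr_gt0 !mulr_gt0// ?exprn_gt0 ?powR_gt0//.
by rewrite ltr0n (leq_ltn_trans _ id).
Qed.

Lemma sieve_evidence l d k N t x : 2 * l < 1 -> (d <= N)%N ->
  (\int[sieve_prior eps d k%:R]_th
    (expR (l * (\sum_(i < N) (th i - t i) ^+ 2) / eps ^+ 2) * gauss_lik eps N th x)%:E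
   = (expR (\sum_(i < N) log_evidence eps l (var_ratio d k i) (t i) (x i)))%:E)%E.
Proof.
move=> l1 dN.
pose phi i (y : R) :=
  expR (l * (y - t i) ^+ 2 / eps ^+ 2 + (y * x i - y ^+ 2 / 2) / eps ^+ 2).
under eq_integral => th _.
  rewrite (_ : _ * _ = \prod_(i < N) phi i (th i)); last first.
    rewrite /gauss_lik -expRD -expR_sum; congr expR.
    by rewrite mulr_sumr mulr_suml -big_split.
  over.
have mphi i : measurable_fun setT (phi i).
  apply: measurableT_comp => //; apply: measurable_funD; apply: measurable_funM => //.
    apply: measurable_funM => //; apply: measurable_funX => //.
    exact: measurable_funB.
  apply: measurable_funB => //; first exact: measurable_funM.
  by apply: measurable_funM => //; exact: measurable_funX.
rewrite (integral_product_law N (finite_product_lawP _ d) mphi); last first.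
  by move=> i y; exact: expR_ge0.
rewrite expR_sum -prodEFin; apply: eq_bigr => i _.
case: ltnP => id.
  by rewrite (normal_evidence eps0 (T := var_ratio d k i))// ?sieve_sd_gt0 ?sieve_sdE.
rewrite var_ratio_out// log_evidence0 integral_dirac//; last first.
  by apply/measurable_EFinP; exact: mphi.
rewrite diracT mul1e /phi; congr (expR _)%:E.
by rewrite sub0r sqrrN mul0r expr0n/= mul0r subr0 mul0r addr0.
Qed.

End sieve.

(** * Mixtures with exponential weights *)
Section mixture.
Context (R : realType).
Implicit Types (h a b : R).

(** The sum of expR (- (h * j)) over j >= 1. *)
Definition geometric_tail h : R := expR (- h) / (1 - expR (- h)).

Lemma expRN_lt1 h : 0 < h -> expR (- h) < 1.
Proof. by move=> h0; rewrite -expR0 ltr_expR oppr_lt0. Qed.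

Lemma exp_series_le h : 0 < h ->
  (\sum_(0 <= j <oo) (expR (- (h * j.+1%:R)))%:E <= (geometric_tail h)%:E)%E.
Proof.
move=> h0; have q1 := expRN_lt1 h0; have q0 : 0 < expR (- h) := expR_gt0 _.
apply: lime_le.
  by apply: is_cvg_nneseries => n _ _; rewrite lee_fin expR_ge0.
apply: nearW => n; rewrite big_mkord sumEFin lee_fin.
apply: (@le_trans _ _
    (geometric_tail h - expR (- h) ^+ n.+1 / (1 - expR (- h)))); last first.
  by rewrite gerBl divr_ge0 ?exprn_ge0 ?ltW// subr_gt0.
rewrite /geometric_tail -mulrBl ler_pdivlMr ?subr_gt0//.
elim: n => [|n IH]; first by rewrite big_ord0 mul0r expr1 subrr.
rewrite big_ord_recr/= mulrDl -(lerBrDr _).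
apply: le_trans IH _.
rewrite (_ : expR (- (h * n.+1%:R)) = expR (- h) ^+ n.+1); last first.
  by rewrite -expRM_natr mulNr.
by rewrite [_ ^+ n.+2]exprS le_eqVlt; apply/orP; left; apply/eqP; ring.
Qed.

Lemma exp_weightE h : 0 < h -> exists2 Z : R, 0 < Z &
  forall n, exp_weight h n = expR (- (h * n%:R)) / Z.
Proof.
move=> h0; exists (fine (\sum_(1 <= j <oo) (expR (- (h * j%:R)))%:E)%E) => //.
have e0 j : (0 <= (expR (- (h * j%:R)))%:E)%E by rewrite lee_fin expR_ge0.
rewrite -(nneseries_addn (f := fun j => (expR (- (h * j%:R)))%:E))//.
apply: fine_gt0; apply/andP; split.
  apply: (@lt_le_trans _ _ (\sum_(0 <= j < 1) (expR (- (h * (j + 1)%:R)))%:E)%E).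
    by rewrite big_nat1 lte_fin expR_gt0.
  by apply: nneseries_lim_ge => n _ _.
apply: le_lt_trans (ltry (geometric_tail h)).
apply: le_trans (exp_series_le h0).
by apply: lee_nneseries => n _; rewrite // addn1.
Qed.

Lemma integral_exp_mixture h (mu : nat -> {measure set (rseq R) -> \bar R})
    (A : set (rseq R)) (f : rseq R -> \bar R) :
  measurable A -> measurable_fun setT f -> (forall x, 0 <= f x)%E ->
  (\int[exp_mixture h mu]_(x in A) f x =
   \sum_(0 <= n <oo) ((exp_weight h n.+1)%:E * \int[mu n.+1]_(x in A) f x))%E.
Proof.
move=> mA mf f0.
pose w n := mscale (NngNum (exp_weight_ge0 h n)) (mu n).
have mfA : measurable_fun A f by exact: measurable_funTS.
transitivity (\int[mseries (fun n => w n.+1) 0]_(x in A) f x)%E.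
  apply: eq_measure_integral => B mB _.
  transitivity (\sum_(1 <= n <oo) w n B)%E => //.
  rewrite -nneseries_addn//.
  by apply: eq_eseriesr => n _; rewrite addn1.
rewrite ge0_integral_measure_series//; apply: eq_eseriesr => n _.
by rewrite ge0_integral_mscale.
Qed.

(** The ratio a y / D is at most 1 and at most expR z with z = r + g - m, hence at
    most expR (z / 2), whatever the sign of z. *)
Lemma ratio_le_expR_half (a b r g m : R) (y D : \bar R) : 0 < b ->
  a = b * expR r -> (0 <= y)%E -> (y <= (expR g)%:E)%E ->
  ((b * expR m)%:E <= D)%E -> (a%:E * y <= D)%E ->
  (a%:E * y / D <= (expR ((r + g - m) / 2))%:E)%E.
Proof.
move=> b0 aE; have a0 : 0 < a by rewrite aE mulr_gt0 ?expR_gt0.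
case: y => [y| |]//.
move=> y0 yg.
case: D => [D| |]; last 2 first.
- by move=> _ _; rewrite invey mule0 lee_fin expR_ge0.
- by rewrite leeNy_eq.
rewrite -EFinM !lee_fin in y0 yg * => bD aD.
have bm0 : 0 < b * expR m by rewrite mulr_gt0 ?expR_gt0.
have D0 : 0 < D by exact: lt_le_trans bD.
rewrite inver gt_eqF// -EFinM lee_fin ler_pdivrMr//.
have [z0|z0] := leP 0 (r + g - m).
  apply: le_trans aD _; apply: ler_peMl; first exact: ltW.
  by rewrite -expR0 ler_expR divr_ge0.
apply: (@le_trans _ _ (b * expR (r + g))).
  by rewrite aE expRD -!mulrA ler_pM2l// ler_pM2l ?expR_gt0.
apply: (@le_trans _ _ (expR (r + g - m) * (b * expR m))).
  by rewrite mulrCA -expRD subrK.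
apply: ler_pM; rewrite ?expR_ge0 ?(ltW bm0) ?ler_expR//; lra.
Qed.

End mixture.

Section posterior_bound.
Context (R : realType).

(** The quotient of two mixtures is bounded term by term: the denominator is at
    least the term (k, d) of its own sum, and at least the reference term
    (k0, d0). *)
Lemma mixture_ratio_le (W w : nat -> R) (F G : nat -> nat -> \bar R)
    (c g : nat -> nat -> R) (m : R) (k0 d0 : nat) :
  (forall k, 0 < W k) -> (forall d, 0 < w d) ->
  (forall k d, 0 <= G k d)%E -> (forall k d, G k d <= F k d)%E ->
  (forall k d, W k * w d = W k0 * w d0 * expR (c k d)) ->
  (forall k d, G k d <= (expR (g k d))%:E)%E -> ((expR m)%:E <= F k0 d0)%E ->
  ((\sum_(0 <= k <oo) ((W k)%:E * \sum_(0 <= d <oo) ((w d)%:E * G k d))) /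
   (\sum_(0 <= k <oo) ((W k)%:E * \sum_(0 <= d <oo) ((w d)%:E * F k d))) <=
   \sum_(0 <= k <oo) \sum_(0 <= d <oo) (expR ((c k d + g k d - m) / 2))%:E)%E.
Proof.
move=> W0 w0 G0 GF WwE Gg mF.
have F0 k d : (0 <= F k d)%E by exact: le_trans (GF k d).
have W0E k : (0 <= (W k)%:E)%E by rewrite lee_fin ltW.
have w0E d : (0 <= (w d)%:E)%E by rewrite lee_fin ltW.
have wG0 k d : (0 <= (w d)%:E * G k d)%E by exact: mule_ge0.
have wF0 k d : (0 <= (w d)%:E * F k d)%E by exact: mule_ge0.
have swG0 k : (0 <= \sum_(0 <= d <oo) ((w d)%:E * G k d))%E.
  by apply: nneseries_ge0 => d _ _; exact: wG0.
have swF0 k : (0 <= \sum_(0 <= d <oo) ((w d)%:E * F k d))%E.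
  by apply: nneseries_ge0 => d _ _; exact: wF0.
have b0 : 0 < W k0 * w d0 by exact: mulr_gt0.
set D := (X in (_ / X)%E).
have D_ge k d : ((W k * w d)%:E * F k d <= D)%E.
  rewrite EFinM -muleA; apply: (@le_trans _ _
      ((W k)%:E * \sum_(0 <= d <oo) ((w d)%:E * F k d))%E).
    apply: lee_wpmul2l; first exact: W0E.
    by apply: (nneseries_term_le (f := fun d => ((w d)%:E * F k d)%E)); exact: wF0.
  apply: (nneseries_term_le
    (f := fun k => ((W k)%:E * \sum_(0 <= d <oo) ((w d)%:E * F k d))%E)) => i.
  by apply: mule_ge0; [exact: W0E|exact: swF0].
have bD : ((W k0 * w d0 * expR m)%:E <= D)%E.
  apply: le_trans (D_ge k0 d0); rewrite EFinM; apply: lee_wpmul2l => //.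
  by rewrite lee_fin ltW.
have D0 : (0 < D)%E by apply: lt_le_trans bD; rewrite lte_fin mulr_gt0 ?expR_gt0.
have term k d :
    ((W k * w d)%:E * G k d / D <= (expR ((c k d + g k d - m) / 2))%:E)%E.
  apply: (ratio_le_expR_half b0 (WwE k d) (G0 k d) (Gg k d) bD).
  apply: le_trans (D_ge k d); apply: lee_wpmul2l => //.
  by rewrite lee_fin ltW// mulr_gt0.
have [r r0 DV] : exists2 r : R, 0 <= r & (D^-1 = r%:E)%E.
  move: D0; case: (D) => [y| |]//; rewrite ?lte_fin => y0.
    by exists y^-1; rewrite ?invr_ge0 ?ltW// inver gt_eqF.
  by exists 0.
rewrite DV muleC -nneseriesZl; last first.
  by move=> k _; apply: mule_ge0; [exact: W0E|exact: swG0].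
have r0E : (0 <= r%:E)%E by rewrite lee_fin.
apply: lee_nneseries => k _.
  by move=> _; apply: mule_ge0 => //; apply: mule_ge0; [exact: W0E|exact: swG0].
rewrite -nneseriesZl; last by move=> d _; exact: wG0.
rewrite -nneseriesZl; last first.
  by move=> d _; apply: mule_ge0; [exact: W0E|exact: wG0].
apply: lee_nneseries => d _.
  by move=> _; apply: mule_ge0 => //; apply: mule_ge0; [exact: W0E|exact: wG0].
by have := term k d; rewrite DV muleC EFinM !muleA.
Qed.

Variables (eps eta gamma : R) (L : rseq R -> rseq R -> \bar R) (x : rseq R).
Hypotheses (heta : 0 < eta) (hgamma : 0 < gamma).
Hypotheses (L0 : forall th, (0 <= L th x)%E)
  (mL : measurable_fun setT (L ^~ x)).

Local Notation S k d := (sieve_prior eps d.+1 k.+1%:R).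

Lemma integral_prior (A : set (rseq R)) : measurable A ->
  (\int[prior eps eta gamma]_(th in A) L th x =
   \sum_(0 <= k <oo) ((exp_weight gamma k.+1)%:E *
     \sum_(0 <= d <oo) ((exp_weight eta d.+1)%:E * \int[S k d]_(th in A) L th x)))%E.
Proof.
move=> mA; rewrite integral_exp_mixture//.
apply: eq_eseriesr => k _; congr (_ * _)%E.
by rewrite integral_exp_mixture.
Qed.

(** The index k stands for the smoothness k.+1 and the index d for the dimension
    d.+1, as the mixtures start at 1. *)
Lemma posterior_le (A : set (rseq R)) (k0 d0 : nat) (g : nat -> nat -> R) (m : R) :
  measurable A ->
  (forall k d, (\int[S k d]_(th in A) L th x <= (expR (g k d))%:E)%E) ->
  ((expR m)%:E <= \int[S k0 d0]_th L th x)%E ->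
  (posterior L (prior eps eta gamma) A x <=
   \sum_(0 <= k <oo) \sum_(0 <= d <oo)
     (expR ((gamma * (k0%:R - k%:R) + eta * (d0%:R - d%:R) + g k d - m) / 2))%:E)%E.
Proof.
move=> mA Ag mL0; rewrite /posterior !integral_prior//.
have [Z1 Z10 WE] := exp_weightE hgamma; have [Z2 Z20 wE] := exp_weightE heta.
apply: (mixture_ratio_le
  (W := fun k => exp_weight gamma k.+1) (w := fun d => exp_weight eta d.+1)
  (F := fun k d => (\int[S k d]_th L th x)%E)
  (G := fun k d => (\int[S k d]_(th in A) L th x)%E)
  (c := fun k d => gamma * (k0%:R - k%:R) + eta * (d0%:R - d%:R)) _ _ _ _ _ Ag mL0).
- by move=> k; rewrite WE divr_gt0// expR_gt0.
- by move=> d; rewrite wE divr_gt0// expR_gt0.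
- by move=> k d; exact: integral_ge0.
- by move=> k d; exact: ge0_subset_integral.
- move=> k d; rewrite !WE !wE mulrACA [in RHS]mulrACA [RHS]mulrAC -!expRD.
  congr (expR _ * _); rewrite -!(natr1 k) -!(natr1 d) -!(natr1 k0) -!(natr1 d0).
  ring.
Qed.

End posterior_bound.

(** * The effective dimension and the ellipsoid *)
Section log_factorial.
Context (R : realType).

(** That is, m ^ m / m! <= e ^ m.  The step from m to m + 1 adds
    m ln (1 + 1 / m) <= 1. *)
Lemma sum_ln_ratio_le (m : nat) :
  \sum_(i < m) (ln m%:R - ln i.+1%:R) <= m%:R :> R.
Proof.
elim: m => [|m IH]; first by rewrite big_ord0.
rewrite big_ord_recr/= subrr addr0.
rewrite (eq_bigr (fun i : 'I_m => (ln m%:R - ln i.+1%:R) +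
  (ln m.+1%:R - ln m%:R))); last by move=> i _; ring.
rewrite big_split/= sumr_const card_ord -natr1 lerD//.
case: m {IH} => [|m]; first by rewrite mulr0n.
rewrite -ln_div ?posrE ?ltr0n// -[leLHS]mulr_natr.
rewrite -ler_pdivlMr ?ltr0n// mulrDl divff ?pnatr_eq0// div1r.
by apply: le_ln1Dx; rewrite (lt_trans _ (_ : 0 < _))// invr_gt0.
Qed.

Lemma sum_ln_var_ratio_le (d k : nat) :
  \sum_(i < d) ln (var_ratio R d k i) <= (2 * k%:R + 1) * d%:R.
Proof.
apply: (@le_trans _ _ ((2 * k%:R + 1) * \sum_(i < d) (ln d%:R - ln i.+1%:R))).
  rewrite mulr_sumr; apply: ler_sum => i _.
  rewrite /var_ratio ltn_ord ln_powR ln_div ?posrE// ltr0n.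
  exact: leq_ltn_trans (ltn_ord i).
by rewrite ler_wpM2l ?sum_ln_ratio_le// addr_ge0// mulr_ge0.
Qed.

End log_factorial.

Section scales.
Context (R : realType) (a eps B : R).
Hypotheses (a0 : 0 < a) (eps0 : 0 < eps) (B0 : 0 < B).

(** The dimension at which the squared bias B^2 n^(-2 a) balances the variance
    eps^2 n, see [eff_dim_sqr]. *)
Definition eff_dim : R := (B / eps) `^ (2 / (2 * a + 1)).
Local Notation n := eff_dim.

Let r0 : 0 < B / eps. Proof. exact: divr_gt0. Qed.
Let k0 : 0 < 2 * a + 1. Proof. by rewrite addr_gt0// mulr_gt0. Qed.

Lemma eff_dim_ge1 : eps / B < 1 -> 1 <= n.
Proof.
rewrite ltr_pdivrMr// mul1r => eB.
apply: (@le_trans _ _ (1 `^ (2 / (2 * a + 1)))); first by rewrite powR1.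
rewrite ge0_ler_powR ?nnegrE//; last by rewrite ler_pdivlMr// mul1r ltW.
- by rewrite divr_ge0// ltW.
- exact: ltW.
Qed.

Lemma eff_dim_gt0 : 0 < n. Proof. exact: powR_gt0. Qed.

Lemma eff_dim_sqr : B ^+ 2 = eps ^+ 2 * n `^ (2 * a + 1).
Proof.
rewrite /eff_dim -powRrM divfK ?gt_eqF// powR_mulrn ?ltW// expr_div_n mulrC.
by rewrite divfK// expf_neq0// gt_eqF.
Qed.

Lemma eff_dim_rate : (eps / B) `^ (4 * a / (2 * a + 1)) * B ^+ 2 = eps ^+ 2 * n.
Proof.
rewrite -[eps / B]invf_div -(powR_inv1 (ltW r0)) -powRrM mulN1r.
have -> : B ^+ 2 = (B / eps) `^ 2 * eps ^+ 2.
  by rewrite powR_mulrn ?ltW// expr_div_n divfK// expf_neq0// gt_eqF.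
rewrite mulrA -powRD; last by rewrite (gt_eqF r0) implybT.
rewrite [LHS]mulrC /eff_dim.
congr (_ * _ `^ _).
by field; rewrite gt_eqF.
Qed.

Definition ellipsoid_weight (d i : nat) : R := (i.+1%:R / d%:R) `^ (2 * a).

Lemma ellipsoid_weight_ge0 d i : 0 <= ellipsoid_weight d i.
Proof. exact: powR_ge0. Qed.

Lemma ellipsoid_weight_ge1 d i : (0 < d)%N -> (d <= i.+1)%N -> 1 <= ellipsoid_weight d i.
Proof.
move=> d0 di; apply: (@le_trans _ _ (1 `^ (2 * a))); first by rewrite powR1.
rewrite ge0_ler_powR ?nnegrE ?divr_ge0 ?mulr_ge0 ?(ltW a0)//.
by rewrite ler_pdivlMr ?ltr0n// mul1r ler_nat.
Qed.

(** A prior at least as smooth as the ellipsoid penalises a coordinate at most as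
    much as the ellipsoid does; this is where k0 has to depend on alpha0. *)
Lemma ellipsoid_weight_var_ratio d k i : (i < d)%N -> a <= k%:R ->
  (var_ratio R d k i)^-1 <= ellipsoid_weight d i.
Proof.
move=> id ak; have d0 : (0 < d)%N by exact: leq_ltn_trans id.
have x0 : 0 <= d%:R / i.+1%:R :> R by rewrite divr_ge0.
rewrite /var_ratio id -powRN -mulN1r powRrM powR_inv1// invf_div.
apply: ger_powR; last by lra.
by rewrite divr_gt0 ?ltr0n//= ler_pdivrMr ?ltr0n// mul1r ler_nat.
Qed.

(** The weighted sum is at most d^(-2 a) B^2, which is at most
    n^(-2 a) B^2 = eps^2 n.  It controls at once the head of th0, against the
    prior variances, and its tail, where the weights are at least 1. *)
Lemma ellipsoid_sum_le (th0 : rseq R) (d : nat) : n <= d%:R ->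
  sobolev_ellipsoid a B th0 ->
  (\sum_(0 <= i <oo) (ellipsoid_weight d i * th0 i ^+ 2)%:E <= (eps ^+ 2 * n)%:E)%E.
Proof.
move=> nd [_ hth]; have n0 := eff_dim_gt0.
have d0 : 0 < d%:R :> R by exact: lt_le_trans nd.
under eq_eseriesr => i _.
  rewrite /ellipsoid_weight powRM ?invr_ge0 ?ltW// mulrAC mulrC EFinM.
  over.
rewrite nneseriesZl//; last by move=> i _; rewrite lee_fin mulr_ge0 ?powR_ge0 ?sqr_ge0.
apply: (@le_trans _ _ ((d%:R^-1 `^ (2 * a))%:E * (B ^+ 2)%:E)%E).
  by rewrite lee_wpmul2l// lee_fin powR_ge0.
rewrite -EFinM lee_fin eff_dim_sqr.
apply: (@le_trans _ _ (n^-1 `^ (2 * a) * (eps ^+ 2 * n `^ (2 * a + 1)))).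
  apply: ler_wpM2r; first by apply: mulr_ge0; [exact: sqr_ge0|exact: powR_ge0].
  by rewrite ge0_ler_powR ?nnegrE ?mulr_ge0 ?invr_ge0 ?(ltW a0) ?(ltW n0)// lef_pV2.
rewrite mulrCA ler_pM2l ?exprn_gt0//.
rewrite -(powR_inv1 (ltW n0)) -powRrM -powRD; last by rewrite (gt_eqF n0) implybT.
have -> : -1 * (2 * a) + (2 * a + 1) = 1 by ring.
by rewrite powRr1 ?(ltW n0).
Qed.

End scales.

(** * Moments over the far set *)
Section far_set.
Context (R : realType) (B : R) (B0 : 0 < B) (th0 : rseq R).

Definition far_set (rho : R) : set (rseq R) :=
  [set th : rseq R | l2 th /\
    (rho%:E <= sqnorm (fun i => (th i - th0 i)%R) / (B ^+ 2)%R%:E)%E].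

Lemma measurable_sqnorm_shift (c : nat -> R) :
  measurable_fun [set: rseq R] (fun th : rseq R => sqnorm (fun i => th i - c i)).
Proof.
rewrite /sqnorm; apply: (ge0_emeasurable_sum (P := xpredT)) => i.
  by move=> th _ _; rewrite lee_fin sqr_ge0.
move=> _; apply/measurable_EFinP; apply: measurable_funX; apply: measurable_funB => //.
exact: measurable_coord.
Qed.

Lemma measurable_far_set rho : measurable (far_set rho).
Proof.
rewrite (_ : far_set rho = [set th | (sqnorm th < +oo)%E] `&`
  [set th : rseq R | (rho%:E <= sqnorm (fun i => (th i - th0 i)%R) / (B ^+ 2)%R%:E)%E])//.
apply: measurableI; rewrite -[X in measurable X]setTI.
  apply: emeasurable_fun_infty_o => //.
  have := measurable_sqnorm_shift (fun=> 0); congr (measurable_fun _ _).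
  by apply/funext => th; congr (sqnorm _); apply/funext => i; rewrite subr0.
apply: emeasurable_fun_c_infty => //; apply: emeasurable_funM => //.
exact: measurable_sqnorm_shift.
Qed.

(** Beyond N the difference th - th0 is - th0, so a far th is already far on the
    first N coordinates. *)
Lemma far_set_head_ge rho M N th : far_set rho th -> supported N th ->
  (\sum_(N <= i <oo) (th0 i ^+ 2)%:E <= M%:E)%E ->
  rho * B ^+ 2 - M <= \sum_(i < N) (th i - th0 i) ^+ 2.
Proof.
move=> [_ far] sth tail; have B20 : 0 < B ^+ 2 by rewrite exprn_gt0.
move: far; rewrite inver gt_eqF// lee_pdivlMr// -EFinM (sqnorm_split N) => far.
rewrite lerBlDr -lee_fin EFinD; apply: le_trans far _.
rewrite leeD2l//; apply: le_trans tail.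
rewrite le_eqVlt; apply/orP; left; apply/eqP.
rewrite -nneseries_addn; last by move=> i; rewrite lee_fin sqr_ge0.
rewrite -[RHS]nneseries_addn; last by move=> i; rewrite lee_fin sqr_ge0.
by apply: eq_eseriesr => i _; rewrite sth ?leq_addl// sub0r sqrrN.
Qed.

End far_set.

Section moments.
Context (R : realType) (a eps B : R).
Hypotheses (a0 : 0 < a) (eps0 : 0 < eps) (B0 : 0 < B).
Local Notation n := (eff_dim a eps B).
Variables (th0 : rseq R).
Hypothesis hth0 : sobolev_ellipsoid a B th0.
Variables (d0 k0 : nat).
Hypotheses (nd0 : n <= d0%:R) (ak0 : a <= k0%:R).

Let d0_gt0 : (0 < d0)%N.
Proof. by rewrite -(ltr_nat R) (lt_le_trans (eff_dim_gt0 a eps0 B0)). Qed.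

Lemma ellipsoid_head_le N :
  \sum_(i < N) ellipsoid_weight a d0 i * (th0 i / eps) ^+ 2 <= n.
Proof.
have h : \sum_(i < N) ellipsoid_weight a d0 i * th0 i ^+ 2 <= eps ^+ 2 * n.
  rewrite -lee_fin -sumEFin; apply: le_trans (ellipsoid_sum_le a0 eps0 B0 nd0 hth0).
  rewrite -(big_mkord xpredT (fun i => (ellipsoid_weight a d0 i * th0 i ^+ 2)%:E)).
  apply: nneseries_lim_ge => i _ _.
  by rewrite lee_fin mulr_ge0 ?ellipsoid_weight_ge0 ?sqr_ge0.
rewrite (eq_bigr (fun i : 'I_N => eps ^- 2 * (ellipsoid_weight a d0 i * th0 i ^+ 2))).
  by rewrite -mulr_sumr mulrC ler_pdivrMr ?exprn_gt0// mulrC.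
by move=> i _; rewrite expr_div_n mulrA mulrC.
Qed.

Lemma ellipsoid_tail_le N : (d0 <= N)%N ->
  (\sum_(N <= i <oo) (th0 i ^+ 2)%:E <= (eps ^+ 2 * n)%:E)%E.
Proof.
move=> dN; have w0 i : (0 <= (ellipsoid_weight a d0 i * th0 i ^+ 2)%:E)%E.
  by rewrite lee_fin mulr_ge0 ?ellipsoid_weight_ge0 ?sqr_ge0.
apply: le_trans (ellipsoid_sum_le a0 eps0 B0 nd0 hth0).
apply: (@le_trans _ _
    (\sum_(N <= i <oo) (ellipsoid_weight a d0 i * th0 i ^+ 2)%:E)%E).
  rewrite -nneseries_addn; last by move=> i; rewrite lee_fin sqr_ge0.
  rewrite -[leRHS]nneseries_addn//; apply: lee_nneseries => i _.
    by move=> _; rewrite lee_fin sqr_ge0.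
  rewrite lee_fin ler_peMl ?sqr_ge0// ellipsoid_weight_ge1 ?d0_gt0//.
  by rewrite (leq_trans dN)// leqW// leq_addl.
rewrite [leRHS](nneseries_split _ N)// add0n leeDr//.
by apply: sume_ge0 => i _; exact: w0.
Qed.

(** The logarithm of the bounds of [half_evidence_ratio_in] and
    [half_evidence_ratio_out]. *)
Definition coord_bound (i : nat) : R :=
  if (i < d0)%N then 1 + ln (var_ratio R d0 k0 i) / 4 +
    (th0 i / eps) ^+ 2 / var_ratio R d0 k0 i
  else (th0 i / eps) ^+ 2.

Lemma sum_coord_bound_le N : (d0 <= N)%N ->
  \sum_(i < N) coord_bound i <= d0%:R + (2 * k0%:R + 1) * d0%:R / 4 + n.
Proof.
move=> dN; pose l i : R := if (i < d0)%N then 1 + ln (var_ratio R d0 k0 i) / 4 else 0.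
apply: (@le_trans _ _ (\sum_(i < N) (l i +
    ellipsoid_weight a d0 i * (th0 i / eps) ^+ 2))).
  apply: ler_sum => i _; rewrite /coord_bound /l; case: ltnP => id.
    rewrite lerD2l mulrC ler_wpM2r ?sqr_ge0//.
    exact: ellipsoid_weight_var_ratio.
  rewrite add0r ler_peMl ?sqr_ge0// ellipsoid_weight_ge1 ?d0_gt0//.
  exact: leqW.
rewrite big_split/=; apply: lerD; last exact: ellipsoid_head_le.
rewrite /l -big_mkcond/= -(big_ord_widen N
  (fun i => 1 + ln (var_ratio R d0 k0 i) / 4) dN) big_split/=.
rewrite sumr_const card_ord lerD2l -mulr_suml ler_pM2r ?invr_gt0//.
exact: sum_ln_var_ratio_le.
Qed.

(** The bound depends neither on d nor on k: only the prior weights and the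
    constant c distinguish the components. *)
Lemma half_moment_le (P : probability (rseq R) R) d k N (c : R) :
  is_product_law (fun i => normal_prob (th0 i) eps) P -> (d0 <= N)%N ->
  (\int[P]_x (expR (c + \sum_(i < N)
     (log_evidence eps (1 / 16) (var_ratio R d k i) (th0 i) (x i) -
      log_evidence eps 0 (var_ratio R d0 k0 i) (th0 i) (x i)) / 2))%:E
   <= (expR (c + (d0%:R + (2 * k0%:R + 1) * d0%:R / 4 + n)))%:E)%E.
Proof.
move=> Plaw dN.
pose phi i (y : R) := expR ((log_evidence eps (1 / 16) (var_ratio R d k i) (th0 i) y -
      log_evidence eps 0 (var_ratio R d0 k0 i) (th0 i) y) / 2).
have mle l T t : measurable_fun setT (log_evidence eps l T t : R -> R).
  apply: measurable_funD => //; apply: measurable_funM => //.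
  apply: measurable_funM => //; apply: measurable_funX.
  exact: measurable_funB.
have mphi i : measurable_fun setT (phi i).
  apply: measurableT_comp => //; apply: measurable_funM => //.
  exact: measurable_funB.
have phi0 i y : 0 <= phi i y by exact: expR_ge0.
under eq_integral => x _.
  rewrite expRD expR_sum EFinM.
  over.
rewrite ge0_integralZl//; last 2 first.
- apply/measurable_EFinP; apply: measurable_prod => i _.
  by apply: (measurableT_comp (mphi i)); exact: measurable_coord.
- by move=> x _; rewrite lee_fin; apply: prodr_ge0 => i _; exact: phi0.
rewrite (integral_product_law N Plaw mphi phi0) [X in (_ <= X%:E)%E]expRD EFinM.
rewrite lee_wpmul2l ?lee_fin ?expR_ge0//.
apply: (@le_trans _ _ (expR (\sum_(i < N) coord_bound i))%:E); last first.
  by rewrite lee_fin ler_expR; exact: sum_coord_bound_le.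
apply: (prode_expR_le N (F := fun i => (\int[normal_prob (th0 i) eps]_t (phi i t)%:E)%E)).
  by move=> i; apply: integral_ge0 => y _; rewrite lee_fin; exact: phi0.
move=> i; rewrite /coord_bound; case: ltnP => id.
  apply: half_evidence_ratio_in => //; last exact: var_ratio_ge1.
  by case: (var_ratio_01 R d k i) => [->//|]; exact: le_trans.
rewrite /phi (var_ratio_out R k0 id); apply: half_evidence_ratio_out => //.
exact: var_ratio_01.
Qed.

(** Markov: on the far set the tilt of exponent 1 / 16 is at least
    expR ((C - 1) * n / 16). *)
Lemma numerator_le d k N C x : (d <= N)%N -> (d0 <= N)%N ->
  (\int[sieve_prior eps d k%:R]_(th in far_set B th0
     (C * (eps / B) `^ (4 * a / (2 * a + 1)))) (gauss_lik eps N th x)%:E <=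
   (expR (\sum_(i < N) log_evidence eps (1 / 16) (var_ratio R d k i) (th0 i) (x i)
     + (1 - C) * n / 16))%:E)%E.
Proof.
move=> dN d0N; set A := far_set _ _ _.
have mA : measurable A by exact: measurable_far_set.
have mlik : measurable_fun setT (fun th : rseq R => gauss_lik eps N th x).
  exact: (measurableT_comp (measurable_gauss_lik eps N) (measurable_pair2 x)).
pose H (th : rseq R) := expR (1 / 16 * (\sum_(i < N) (th i - th0 i) ^+ 2) / eps ^+ 2) *
  gauss_lik eps N th x.
have mH : measurable_fun setT H.
  apply: measurable_funM => //; apply: measurableT_comp => //.
  apply: measurable_funM => //; apply: measurable_funM => //.
  apply: measurable_sum => i; apply: measurable_funX; apply: measurable_funB => //.
  exact: measurable_coord.
have H0 th : 0 <= H th by rewrite mulr_ge0 ?expR_ge0.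
rewrite expRD mulrC EFinM -(sieve_evidence eps0 k th0 x _ dN); last by lra.
rewrite -ge0_integralZl//; last 2 first.
- exact/measurable_EFinP.
- by move=> th _; rewrite lee_fin H0.
rewrite [leLHS]integral_mkindic; apply: ae_le_integral.
- by move=> th; rewrite mule_ge0// lee_fin expR_ge0.
- by move=> th; rewrite mule_ge0// lee_fin ?expR_ge0 ?H0.
- by apply: emeasurable_funM => //; exact/measurable_EFinP.
apply: filterS (finite_product_law_supported _ d) => th sth.
rewrite -!EFinM lee_fin.
have [thA|thA] := boolP (th \in A); last first.
  by rewrite indicE (negbTE thA) mulr0 mulr_ge0 ?expR_ge0 ?H0.
rewrite indicE thA mulr1 /H mulrA -expRD ler_peMl ?expR_ge0//.
rewrite -[leLHS]expR0 ler_expR.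
have sthN : supported N th by move=> i Ni; apply: sth; exact: leq_trans Ni.
have := far_set_head_ge B0 (set_mem thA) sthN (ellipsoid_tail_le d0N).
rewrite -mulrA (eff_dim_rate a0 eps0 B0)// => h.
have e20 : 0 < eps ^+ 2 by rewrite exprn_gt0.
have : (C - 1) * n <= (\sum_(i < N) (th i - th0 i) ^+ 2) / eps ^+ 2.
  by rewrite ler_pdivlMr//; apply: le_trans h; nra.
rewrite -[1 / 16 * _ / _]mulrA; set z := _ / eps ^+ 2 => hz.
by nra.
Qed.

End moments.

(** * The expected posterior mass of the far set *)
Section posterior_expectation.
Context (R : realType) (a eps B eta gamma : R).
Hypotheses (a0 : 0 < a) (eps0 : 0 < eps) (B0 : 0 < B)
  (heta : 0 < eta) (hgamma : 0 < gamma).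
Local Notation n := (eff_dim a eps B).
Variables (P : rseq R -> probability (rseq R) R)
  (L : rseq R -> rseq R -> \bar R).
Hypotheses (PG : is_gauss_seq eps P) (PL : is_likelihood P L).
Variables (th0 : rseq R).
Hypothesis hth0 : sobolev_ellipsoid a B th0.
Variables (d0 k0 : nat) (C : R).
Hypotheses (nd0 : n <= d0.+1%:R) (ak0 : a <= k0.+1%:R).

Local Notation A := (far_set B th0 (C * (eps / B) `^ (4 * a / (2 * a + 1)))).

(** The sums run over maxn d.+1 d0.+1 coordinates, enough for both the component
    (k, d) and the reference component (k0, d0). *)
Let num (k d : nat) (x : rseq R) : R :=
  \sum_(i < maxn d.+1 d0.+1)
    log_evidence eps (1 / 16) (var_ratio R d.+1 k.+1 i) (th0 i) (x i)
  + (1 - C) * n / 16.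

Let den (x : rseq R) : R :=
  \sum_(i < d0.+1) log_evidence eps 0 (var_ratio R d0.+1 k0.+1 i) (th0 i) (x i).

Let prior_gap (k d : nat) : R := gamma * (k0%:R - k%:R) + eta * (d0%:R - d%:R).

(** Coordinates beyond d0 add nothing to the evidence of the reference
    component. *)
Let den_widen d x : den x = \sum_(i < maxn d.+1 d0.+1)
  log_evidence eps 0 (var_ratio R d0.+1 k0.+1 i) (th0 i) (x i).
Proof.
rewrite /den (big_ord_widen (maxn d.+1 d0.+1) (fun i =>
  log_evidence eps 0 (var_ratio R d0.+1 k0.+1 i) (th0 i) (x i)) (leq_maxr _ _)).
rewrite big_mkcond/=; apply: eq_bigr => i _; case: ltnP => // id.
by rewrite (var_ratio_out R k0.+1 id) log_evidence0 !mul0r.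
Qed.

Let exponentE k d x : (prior_gap k d + num k d x - den x) / 2 =
  prior_gap k d / 2 + (1 - C) * n / 32 + \sum_(i < maxn d.+1 d0.+1)
     (log_evidence eps (1 / 16) (var_ratio R d.+1 k.+1 i) (th0 i) (x i) -
      log_evidence eps 0 (var_ratio R d0.+1 k0.+1 i) (th0 i) (x i)) / 2.
Proof. by rewrite (den_widen d) /num -mulr_suml sumrB; field. Qed.

(** The bounds hold almost everywhere under P 0, hence under P th0, which has a
    density with respect to P 0. *)
Let posterior_le_ae : {ae P th0, forall x, (posterior L (prior eps eta gamma) A x <=
  \sum_(0 <= k <oo) \sum_(0 <= d <oo)
    (expR ((prior_gap k d + num k d x - den x) / 2))%:E)%E}.
Proof.
have [L0 mL dL] := PL.
have mA : measurable A by exact: measurable_far_set.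
have dom : P th0 `<< P (fun=> 0).
  apply/null_content_dominatesP => E mE E0; rewrite (dL th0 hth0.1 E mE).
  apply: null_set_integral => //; apply: measurable_funTS.
  exact: (measurableT_comp mL (measurable_pair1 th0)).
have ae_num : {ae P (fun=> 0), forall x, forall k d,
    (\int[sieve_prior eps d.+1 k.+1%:R]_(th in A) L th x <= (expR (num k d x))%:E)%E}.
  apply: ae_foralln => k; apply: ae_foralln => d.
  have sN : {ae sieve_prior eps d.+1 k.+1%:R, forall th,
      supported (maxn d.+1 d0.+1) th}.
    apply: filterS (finite_product_law_supported _ d.+1) => th sth i di.
    by apply: sth; rewrite (leq_trans (leq_maxl _ _) di).
  apply: filterS (marginal_likelihood_ae eps0 PG PL mA sN) => x /(_ I) ->.
  by apply: (numerator_le a0 eps0 B0 hth0 nd0); [exact: leq_maxl|exact: leq_maxr].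
have ae_den : {ae P (fun=> 0), forall x,
    ((expR (den x))%:E <= \int[sieve_prior eps d0.+1 k0.+1%:R]_th L th x)%E}.
  have sN : {ae sieve_prior eps d0.+1 k0.+1%:R, forall th, supported d0.+1 th}.
    exact: finite_product_law_supported.
  apply: filterS (marginal_likelihood_ae eps0 PG PL measurableT sN) => x /(_ I) ->.
  rewrite -(sieve_evidence eps0 _ _ _ _ (leqnn _)); last by rewrite mulr0.
  by under eq_integral do rewrite !mul0r expR0 mul1r.
have [N [mN N0 hN]] : {ae P (fun=> 0), forall x, (forall k d,
    (\int[sieve_prior eps d.+1 k.+1%:R]_(th in A) L th x <= (expR (num k d x))%:E)%E)
    /\ ((expR (den x))%:E <= \int[sieve_prior eps d0.+1 k0.+1%:R]_th L th x)%E}.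
  by apply: filterS2 ae_num ae_den => x; split.
exists N; split => //; first by move/null_content_dominatesP : dom; exact.
apply: subset_trans hN => x /= hx [hnum hden]; apply: hx.
apply: posterior_le => //.
exact: (measurableT_comp mL (measurable_pair2 x)).
Qed.

Let measurable_exponent k d :
  measurable_fun setT (fun x => (expR ((prior_gap k d + num k d x - den x) / 2))%:E).
Proof.
have mle l T i : measurable_fun [set: rseq R]
    (fun x : rseq R => log_evidence eps l T (th0 i) (x i)).
  apply: measurable_funD => //; apply: measurable_funM => //.
  apply: measurable_funM => //; apply: measurable_funX.
  by apply: measurable_funB => //; exact: measurable_coord.
apply/measurable_EFinP; apply: measurableT_comp => //.
apply: measurable_funM => //; apply: measurable_funB.
  by apply: measurable_funD => //; apply: measurable_funD => //; apply: measurable_sum.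
by apply: measurable_sum.
Qed.

Lemma posterior_expectation_le :
  (\int[P th0]_x posterior L (prior eps eta gamma) A x <=
   (expR ((gamma * k0.+1%:R + eta * d0.+1%:R) / 2 + (1 - C) * n / 32 +
     (d0.+1%:R + (2 * k0.+1%:R + 1) * d0.+1%:R / 4 + n)) *
    (geometric_tail (gamma / 2) * geometric_tail (eta / 2)))%:E)%E.
Proof.
have [L0 mL dL] := PL.
set E0 := expR _.
have e0 k d x : (0 <= (expR ((prior_gap k d + num k d x - den x) / 2))%:E)%E.
  by rewrite lee_fin expR_ge0.
have se0 k x : (0 <= \sum_(0 <= d <oo)
    (expR ((prior_gap k d + num k d x - den x) / 2))%:E)%E.
  by apply: nneseries_ge0 => d _ _; exact: e0.
have mse k : measurable_fun setT (fun x => \sum_(0 <= d <oo)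
    (expR ((prior_gap k d + num k d x - den x) / 2))%:E)%E.
  by apply: (ge0_emeasurable_sum (P := xpredT)) => d.
apply: le_trans (ae_le_integral _ _ _ posterior_le_ae) _.
- move=> x; apply: mule_ge0; first by apply: integral_ge0.
  by rewrite inve_ge0; apply: integral_ge0.
- by move=> x; apply: nneseries_ge0 => k _ _; exact: se0.
- by apply: (ge0_emeasurable_sum (P := xpredT)) => k.
rewrite integral_nneseries//.
have term k d : (\int[P th0]_x (expR ((prior_gap k d + num k d x - den x) / 2))%:E <=
    (E0 * expR (- (gamma / 2 * k.+1%:R)))%:E * (expR (- (eta / 2 * d.+1%:R)))%:E)%E.
  under eq_integral do rewrite exponentE.
  apply: le_trans (half_moment_le a0 eps0 B0 hth0 nd0 ak0 _ _ _ (PG hth0.1)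
    (leq_maxr _ _)) _.
  rewrite -EFinM lee_fin /E0 -!expRD ler_expR /prior_gap.
  by rewrite -!(natr1 k) -!(natr1 d) -!(natr1 k0) -!(natr1 d0); lra.
have E00 : 0 <= E0 by exact: expR_ge0.
apply: (@le_trans _ _ (\sum_(0 <= k <oo) ((E0 * geometric_tail (eta / 2))%:E *
    (expR (- (gamma / 2 * k.+1%:R)))%:E))%E).
  apply: lee_nneseries => k _; first by move=> _; apply: integral_ge0.
  rewrite integral_nneseries//.
  apply: (@le_trans _ _ (\sum_(0 <= d <oo) ((E0 * expR (- (gamma / 2 * k.+1%:R)))%:E *
      (expR (- (eta / 2 * d.+1%:R)))%:E))%E).
    by apply: lee_nneseries => d _; [move=> _; apply: integral_ge0|exact: term].
  rewrite nneseriesZl; last by move=> d _; rewrite lee_fin expR_ge0.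
  rewrite [in leRHS]EFinM muleAC -EFinM [leRHS]EFinM; apply: lee_wpmul2l.
    by rewrite lee_fin mulr_ge0// expR_ge0.
  by apply: exp_series_le; rewrite divr_gt0.
rewrite nneseriesZl; last by move=> k _; rewrite lee_fin expR_ge0.
rewrite [X in (_ <= X%:E)%E](_ : _ =
  E0 * geometric_tail (eta / 2) * geometric_tail (gamma / 2)); last first.
  by rewrite -[RHS]mulrA; congr (_ * _); rewrite mulrC.
rewrite [leRHS]EFinM; apply: lee_wpmul2l.
  rewrite lee_fin mulr_ge0// /geometric_tail divr_ge0 ?expR_ge0// subr_ge0.
  by rewrite ltW// expRN_lt1// divr_gt0.
by apply: exp_series_le; rewrite divr_gt0.
Qed.

End posterior_expectation.

Theorem theorem1 (R : realType) (alpha0 eta gamma : R)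
    (halpha0 : 0 < alpha0) (heta : 0 < eta) (hgamma : 0 < gamma) :
  exists C c : R, [/\ 0 < C, 0 < c &
    forall eps B : R, 0 < eps -> 0 < B -> eps / B < 1 ->
    forall (P : rseq R -> probability (rseq R) R)
           (L : rseq R -> rseq R -> \bar R),
      is_gauss_seq eps P -> is_likelihood P L ->
    forall th0 : rseq R, sobolev_ellipsoid alpha0 B th0 ->
      (\int[P th0]_x
         posterior L (prior eps eta gamma)
           [set th : rseq R | l2 th /\
              ((C * (eps / B) `^ (4 * alpha0 / (2 * alpha0 + 1)))%R%:E
                <= sqnorm (fun i => (th i - th0 i)%R) / (B ^+ 2)%R%:E)%E] x
       <= (expR (- (c * (B / eps) `^ (2 / (2 * alpha0 + 1)))))%R%:E)%E].
Proof.
set k0 := Num.truncn alpha0.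
have ak0 : alpha0 <= k0.+1%:R.
  by have /andP[_ /ltW] := truncn_itv (ltW halpha0).
have g0 h : 0 < h -> 0 <= geometric_tail h.
  move=> h0; rewrite /geometric_tail divr_ge0 ?expR_ge0// subr_ge0.
  by rewrite ltW// expRN_lt1.
have Gg0 : 0 <= geometric_tail (gamma / 2) by apply: g0; rewrite divr_gt0.
have Ge0 : 0 <= geometric_tail (eta / 2) by apply: g0; rewrite divr_gt0.
(* K collects the coefficients of n in the exponent, using that the dimension
   d0.+1 is at most 2 n and that each geometric sum g is at most expR (g n). *)
pose K := gamma * k0.+1%:R / 2 + eta + 1 / 32 + 3 + (2 * k0.+1%:R + 1) / 2 +
  geometric_tail (gamma / 2) + geometric_tail (eta / 2).
have gk0 : 0 <= gamma * k0.+1%:R by rewrite mulr_ge0// ltW.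
have kk0 : 0 <= k0.+1%:R :> R by [].
have K0 : 0 < K by rewrite /K; lra.
(* 32 is twice 16: the tilt 1 / 16 is halved by the square root. *)
exists (32 * (K + 1)), 1; split; [lra|by []|].
move=> eps B eps0 B0 eB P L PG PL th0 hth0.
have n1 := eff_dim_ge1 halpha0 eps0 B0 eB.
set n := eff_dim _ _ _ in n1.
pose d0 := Num.truncn n.
have /andP[d0n nd0] : d0%:R <= n < d0.+1%:R by apply: truncn_itv; lra.
apply: le_trans (posterior_expectation_le halpha0 eps0 B0 heta hgamma PG PL hth0
  (32 * (K + 1)) (ltW nd0) ak0) _.
rewrite lee_fin mul1r -/(eff_dim alpha0 eps B) -/n.
have ge_exp g : 0 <= g -> g <= expR (g * n).
  move=> gge; apply: (@le_trans _ _ (g * n)); first by rewrite ler_peMr.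
  by apply: le_trans (expR_ge1Dx _); lra.
apply: (@le_trans _ _ (expR ((gamma * k0.+1%:R + eta * d0.+1%:R) / 2 +
  (1 - 32 * (K + 1)) * n / 32 +
  (d0.+1%:R + (2 * k0.+1%:R + 1) * d0.+1%:R / 4 + n)) *
  (expR (geometric_tail (gamma / 2) * n) * expR (geometric_tail (eta / 2) * n)))).
  rewrite ler_wpM2l ?expR_ge0//.
  by apply: ler_pM => //; exact: ge_exp.
rewrite -!expRD ler_expR.
have d2 : d0.+1%:R <= 2 * n by rewrite -natr1; lra.
have h1 : eta * d0.+1%:R <= eta * (2 * n) by rewrite ler_pM2l.
have h2 : (2 * k0.+1%:R + 1) * d0.+1%:R <= (2 * k0.+1%:R + 1) * (2 * n).
  by rewrite ler_wpM2l//; lra.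
have h3 : gamma * k0.+1%:R <= gamma * k0.+1%:R * n by rewrite ler_peMr.
rewrite /K; lra.
Qed.
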